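(* Let $(\Omega,\mathcal A,\mu)$ be a $\sigma$-finite measure space. For any Dunford-Schwartz operator $T:\mathcal L^1\to\mathcal L^1$ there exists a unique linear operator $\widetilde T:\mathcal L^1+\mathcal L^\infty\to\mathcal L^1+\mathcal L^\infty$ such that \[ \widetilde T(f)=T(f)\ \ \forall\, f\in\mathcal L^1,\qquad \|\widetilde T(f)\|_\infty\le\|f\|_\infty\ \ \forall\, f\in\mathcal L^\infty, \] and the restriction $\widetilde T|_{\mathcal L^\infty}$ is $\sigma(\mathcal L^\infty,\mathcal L^1)$-continuous.
   Context: $\mathcal L^p=\mathcal L^p(\Omega,\mu)$, $1\le p\le\infty$, are the spaces of (a.e. equivalence classes of) complex-valued functions with the usual norms $\|\cdot\|_p$. A linear operator $T:\mathcal L^1\to\mathcal L^1$ is called a Dunford-Schwartz operator if $\|T(f)\|_1\le\|f\|_1$ for all $f\in\mathcal L^1$ and $\|T(f)\|_\infty\le\|f\|_\infty$ for all $f\in\mathcal L^1\cap\mathcal L^\infty$. $\sigma(\mathcal L^\infty,\mathcal L^1)$ denotes the weak-$*$ topology on $\mathcal L^\infty=(\mathcal L^1)^*$. *)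

(* Defs.v *)
From HB Require Import structures.
From mathcomp Require Import all_boot all_order all_algebra.
From mathcomp Require Import generic_quotient ring_quotient.
From mathcomp Require Import all_classical all_reals all_analysis.
From mathcomp Require Import measurable_realfun ess_sup_inf.
From mathcomp Require Import complex.

Set Implicit Arguments.
Unset Strict Implicit.
Unset Printing Implicit Defensive.

Import Order.TTheory GRing.Theory Num.Theory.
Import numFieldNormedType.Exports.

Local Open Scope classical_set_scope.
Local Open Scope ring_scope.
Local Open Scope quotient_scope.

(** The scalars are [(R[i])^o] (convertible to [R[i]]): as the regular module
    it carries the [R[i]]-module structure and the topology of [R[i]]. *)

Section cmfun.
Context d (T : measurableType d) (R : realType).
Implicit Types f g : T -> (R[i])^o.

Definition cmeasurable f :=
  measurable_fun [set: T] (fun x => complex.Re (f x)) /\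
  measurable_fun [set: T] (fun x => complex.Im (f x)).

Definition cmfun : {pred T -> (R[i])^o} := mem [set f | cmeasurable f].

Lemma cmfun_submod_closed : submod_closed cmfun.
Proof.
split; first by rewrite inE; split; exact: measurable_cst.
move=> a f g; rewrite !inE => -[mrf mif] [mrg mig]; split.
- rewrite (_ : (fun x => _) = (fun x => complex.Re a * complex.Re (f x)
    - complex.Im a * complex.Im (f x) + complex.Re (g x))); last first.
    by apply/funext => x; rewrite -[complex.Re _]/(complex.Re (a * f x + g x));
      case: a (f x) (g x) => ? ? [? ?] [? ?].
  by apply: measurable_funD => //; apply: measurable_funB;
    exact: measurable_funM.
- rewrite (_ : (fun x => _) = (fun x => complex.Re a * complex.Im (f x)
    + complex.Im a * complex.Re (f x) + complex.Im (g x))); last first.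
    by apply/funext => x; rewrite -[complex.Im _]/(complex.Im (a * f x + g x));
      case: a (f x) (g x) => ? ? [? ?] [? ?].
  by apply: measurable_funD => //; apply: measurable_funD;
    exact: measurable_funM.
Qed.

HB.instance Definition _ :=
  GRing.isSubmodClosed.Build _ _ cmfun cmfun_submod_closed.

Record cmfunType : Type := CMFun {
  cmfun_fun :> T -> (R[i])^o ;
  cmfun_subproof : cmfun_fun \in cmfun }.

HB.instance Definition _ := [isSub for cmfun_fun].
HB.instance Definition _ := [Choice of cmfunType by <:].
HB.instance Definition _ := [SubChoice_isSubLmodule of cmfunType by <:].

End cmfun.

Section L0.
Context d (T : measurableType d) (R : realType).
Variable mu : {measure set T -> \bar R}.

Definition cnull : {pred cmfunType T R} :=
  mem [set f : cmfunType T R | {ae mu, forall x, f x = 0}].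

Lemma cnull_submod_closed : submod_closed cnull.
Proof.
split; first by rewrite inE; exact: aeW.
move=> a f g; rewrite !inE; apply: filterS2 => x /= f0 g0.
by rewrite -[LHS]/(a *: f x + g x) f0 g0 scaler0 addr0.
Qed.

HB.instance Definition _ :=
  GRing.isSubmodClosed.Build _ _ cnull cnull_submod_closed.

(** Classes of complex-valued measurable functions modulo a.e. equality. *)
Definition L0 : Type := Quotient.quot cnull.
HB.instance Definition _ := GRing.Zmodule.on L0.
HB.instance Definition _ := EqQuotient.on L0.

Definition L0_fun (f : L0) : T -> R[i] := repr f.

Lemma L0_eqP (f g : cmfunType T R) :
  (\pi_L0 f = \pi_L0 g) <-> {ae mu, forall x, f x = g x}.
Proof.
have -> : (\pi_L0 f = \pi_L0 g) <-> (f - g \in cnull).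
  by rewrite Quotient.idealrBE; split => [->|/eqP].
rewrite inE; split; apply: filterS => x.
  by move=> /= /(@subr0_eq (R[i])).
by move=> fg; rewrite -[LHS]/(f x - g x) fg subrr.
Qed.

Definition L0_scale (a : R[i]) (f : L0) : L0 := \pi_L0 (a *: repr f).

Lemma L0_piZ a (f : cmfunType T R) : L0_scale a (\pi_L0 f) = \pi_L0 (a *: f).
Proof.
apply/L0_eqP; have /L0_eqP : \pi_L0 (repr (\pi_L0 f)) = \pi_L0 f :> L0.
  by rewrite reprK.
apply: filterS => x fx; rewrite -[LHS]/(a *: (repr (\pi_L0 f) : cmfunType T R) x).
by rewrite fx.
Qed.

Lemma L0_piD (f g : cmfunType T R) : \pi_L0 f + \pi_L0 g = \pi_L0 (f + g) :> L0.
Proof. by symmetry; exact: (@Quotient.pi_add _ cnull). Qed.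

Fact L0_scaleA a b f : L0_scale a (L0_scale b f) = L0_scale (a * b) f.
Proof. by rewrite -[f]reprK (L0_piZ b) (L0_piZ a) L0_piZ scalerA. Qed.

Fact L0_scale1 : left_id 1 L0_scale.
Proof. by move=> f; rewrite -[f]reprK L0_piZ scale1r. Qed.

Fact L0_scaleDr : right_distributive L0_scale +%R.
Proof.
by move=> a f g; rewrite -[f]reprK -[g]reprK L0_piD !L0_piZ L0_piD scalerDr.
Qed.

Fact L0_scaleDl f : {morph L0_scale^~ f : a b / a + b}.
Proof.
by move=> a b; rewrite -[f]reprK !L0_piZ L0_piD scalerDl.
Qed.

HB.instance Definition _ := GRing.Zmodule_isLmodule.Build (R[i]) L0
  L0_scaleA L0_scale1 L0_scaleDr L0_scaleDl.

Lemma L0_funP (f : cmfunType T R) :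
  {ae mu, forall x, L0_fun (\pi_L0 f) x = f x}.
Proof. by apply/L0_eqP; rewrite reprK. Qed.

Lemma L0_fun_linear a (f g : L0) :
  {ae mu, forall x, L0_fun (a *: f + g) x = a * L0_fun f x + L0_fun g x}.
Proof.
have <- : \pi_L0 (a *: repr f + repr g) = a *: f + g :> L0.
  by rewrite -L0_piD -L0_piZ !reprK.
exact: L0_funP.
Qed.

(** Takes the value [+oo] outside $L^p$. *)
Definition cLnorm (p : \bar R) (f : L0) : \bar R :=
  'N[mu]_p[(fun x => (Normc.normc (L0_fun f x))%:E)]%E.

End L0.

Section Lp.
Context d (T : measurableType d) (R : realType).
Variables (mu : {measure set T -> \bar R}) (p : \bar R) (p1 : (1 <= p)%E).

Lemma normc_measurable (f : cmfunType T R) :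
  measurable_fun [set: T] (fun x => Normc.normc (f x)).
Proof.
have := cmfun_subproof f; rewrite inE => -[mr mi].
rewrite (_ : (fun x => _) = Num.sqrt \o
    (fun x => complex.Re (f x) ^+ 2 + complex.Im (f x) ^+ 2)); last first.
  by apply/funext => x /=; case: (f x).
apply: measurableT_comp.
  by apply: continuous_measurable_fun; exact: (@sqrt_continuous R).
by apply: measurable_funD; exact: measurable_funX.
Qed.

Lemma ae_le_Lnorm (f g : T -> R) :
  measurable_fun [set: T] f -> measurable_fun [set: T] g ->
  {ae mu, forall x, `|f x| <= `|g x|} ->
  ('N[mu]_p[EFin \o f] <= 'N[mu]_p[EFin \o g])%E.
Proof.
move=> mf mg fg; rewrite unlock /Lnorm; case: p p1 => [r|_|//]; last first.
  case: ifPn => // _; apply: le_ess_sup; apply: filterS fg => x /=.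
  by rewrite lee_fin.
rewrite lee_fin => r1; have r0 : 0 <= r by rewrite (le_trans _ r1).
have m (h : T -> R) : measurable_fun [set: T] h ->
    measurable_fun [set: T] (fun x => (`|(EFin \o h) x| `^ r)%E).
  move=> mh; apply: (measurableT_comp (measurable_poweR r)).
  by apply/measurableT_comp => //; exact/measurable_EFinP.
apply: gt0_ler_poweR; rewrite ?invr_ge0//.
- by rewrite in_itv/= leey andbT integral_ge0// => x _; exact: poweR_ge0.
- by rewrite in_itv/= leey andbT integral_ge0// => x _; exact: poweR_ge0.
apply: ae_ge0_le_integral => //; [| exact: m | | exact: m |].
- by move=> x _; exact: poweR_ge0.
- by move=> x _; exact: poweR_ge0.
- apply: filterS fg => x /= fgx _.
  by rewrite lee_fin ge0_ler_powR// nnegrE.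
Qed.

Definition cLp (_ : (1 <= p)%E) : {pred L0 mu} :=
  mem [set f : L0 mu | (cLnorm p f < +oo)%E].

Lemma cLp_submod_closed : submod_closed (cLp p1).
Proof.
have cLpE (f : L0 mu) :
    (f \in cLp p1) = (@Normc.normc R \o L0_fun f \in Lfun mu p).
  apply/idP/idP => [fp|/andP[_ fp]]; last by apply/mem_set; exact: (set_mem fp).
  apply/andP; split; first by apply/mem_set; exact: normc_measurable.
  by apply/mem_set; exact: (set_mem fp).
split.
  rewrite cLpE.
  have : ('N[mu]_p[EFin \o (@Normc.normc R \o L0_fun (0%R : L0 mu))] <=
          'N[mu]_p[EFin \o cst 0%R])%E.
    apply: ae_le_Lnorm => //; first exact: normc_measurable.
    have := L0_funP mu (0 : cmfunType T R).
    have -> : \pi_(L0 mu) (0 : cmfunType T R) = 0.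
      exact: (@pi_zeror _ _ _ _ _ (Quotient.quot (@cnull _ T R mu))).
    by apply: filterS => x /= ->; rewrite Normc.normc0.
  move=> le0; rewrite -cLpE inE/=; apply: (le_lt_trans le0).
  exact: (finite_norm_cst0 mu p1).
move=> a f g; rewrite !cLpE => fp gp.
have := Lfun_submod_closed mu p1 => -[_ /(_ (Normc.normc a) _ _ fp gp)].
rewrite -cLpE !inE/= => /andP[]; rewrite !inE => mh hp.
apply: le_lt_trans hp; apply: ae_le_Lnorm; [exact: normc_measurable|exact: mh|].
apply: filterS (L0_fun_linear a f g) => x /= ->.
have n0 (z : R[i]) : 0 <= Normc.normc z.
  by case: z => ? ?; exact: sqrtr_ge0.
rewrite !ger0_norm ?n0//.
  by rewrite (le_trans (le_normcD _ _))// Normc.normcM.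
by apply: addr_ge0; [apply: mulr_ge0|]; exact: n0.
Qed.

HB.instance Definition _ :=
  GRing.isSubmodClosed.Build _ _ (cLp p1) cLp_submod_closed.

(** The complex space $L^p(T, mu)$, for $1 \le p \le \infty$. *)
Record cLpType : Type := CLp {
  cLp_val :> L0 mu ;
  cLp_subproof : cLp_val \in cLp p1 }.

HB.instance Definition _ := [isSub for cLp_val].
HB.instance Definition _ := [Choice of cLpType by <:].
HB.instance Definition _ := [SubChoice_isSubLmodule of cLpType by <:].

End Lp.

Notation L1 mu := (cLpType mu (@lexx _ _ 1%E)).
Notation Linfty mu := (cLpType mu (leey 1%E)).

Section L1Linfty.
Context d (T : measurableType d) (R : realType).
Variable mu : {measure set T -> \bar R}.

Definition cL1Linfty : {pred L0 mu} :=
  mem [set h : L0 mu | exists (f : L1 mu) (g : Linfty mu), h = val f + val g].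

Lemma cL1Linfty_submod_closed : submod_closed cL1Linfty.
Proof.
split; first by rewrite inE; exists 0, 0; rewrite addr0.
move=> a h k; rewrite !inE => -[f [g ->]] [f' [g' ->]].
by exists (a *: f + f'), (a *: g + g'); rewrite scalerDr addrACA.
Qed.

HB.instance Definition _ :=
  GRing.isSubmodClosed.Build _ _ cL1Linfty cL1Linfty_submod_closed.

(** The algebraic sum $L^1 + L^\infty$, inside [L0 mu]. *)
Record L1Linfty : Type := CL1Linfty {
  L1Linfty_val :> L0 mu ;
  L1Linfty_subproof : L1Linfty_val \in cL1Linfty }.

HB.instance Definition _ := [isSub for L1Linfty_val].
HB.instance Definition _ := [Choice of L1Linfty by <:].
HB.instance Definition _ := [SubChoice_isSubLmodule of L1Linfty by <:].

Fact L1_subproof (f : L1 mu) : val f \in cL1Linfty.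
Proof. by rewrite inE; exists f, 0; rewrite addr0. Qed.

Fact Linfty_subproof (f : Linfty mu) : val f \in cL1Linfty.
Proof. by rewrite inE; exists 0, f; rewrite add0r. Qed.

Definition L1_incl (f : L1 mu) : L1Linfty := CL1Linfty (L1_subproof f).
Definition Linfty_incl (f : Linfty mu) : L1Linfty := CL1Linfty (Linfty_subproof f).

Definition dunford_schwartz (S : {linear L1 mu -> L1 mu}) :=
  (forall f : L1 mu, (cLnorm 1 (S f) <= cLnorm 1 f)%E) /\
  (forall f : L1 mu, val f \in cLp (leey 1%E) ->
     (cLnorm +oo (S f) <= cLnorm +oo f)%E).

Definition cintegral (f : T -> R[i]) : R[i] :=
  Complex (\int[mu]_x complex.Re (f x)) (\int[mu]_x complex.Im (f x)).

Definition duality (f : Linfty mu) (g : L1 mu) : (R[i])^o :=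
  cintegral (fun x => L0_fun f x * L0_fun g x).

(** $\sigma(L^\infty, L^1)$: the coarsest topology on $L^\infty$ making
    [duality^~ g] continuous for every [g] in $L^1$. *)
Definition weak_star : Type := sup_topology (fun g : L1 mu =>
  Topological.on (initial_topology (fun f : Linfty mu => duality f g))).
HB.instance Definition _ := Topological.on weak_star.

(** [Q] is the restriction of [S] to $L^\infty$, as a map into $L^\infty$. *)
Definition Linfty_restriction (S : L1Linfty -> L1Linfty) (Q : Linfty mu -> Linfty mu) :=
  forall f : Linfty mu, S (Linfty_incl f) = Linfty_incl (Q f).

Definition Linfty_weak_star_continuous (S : L1Linfty -> L1Linfty) :=
  exists2 Q : Linfty mu -> Linfty mu,
    Linfty_restriction S Q & continuous (Q : weak_star -> weak_star).

End L1Linfty.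

(* Main.v *)
Require Import Defs.
From HB Require Import structures.
From mathcomp Require Import all_boot all_order all_algebra.
From mathcomp Require Import all_classical all_reals all_analysis.
From mathcomp Require Import complex measurable_realfun ess_sup_inf.
From mathcomp Require Import ring.

(** The extension to bounded classes is the adjoint of a pre-adjoint of the given
    operator [S]. Everything is done in [L0] with the real pairing
    [pair u g = \int Re (u g)], of which the duality is a complex version.

    The pre-adjoint. Fix [g] in L1 and a strictly positive integrable weight [w],
    which sigma-finiteness provides. The functional [f |-> pair (S (w f)) g] on
    bounded real functions is continuous for bounded pointwise convergence
    ([pair_op_cvg]): then [w f_n] converges in L1, hence so do the images, and
    these remain bounded, which is enough to test them against an unbounded [g].
    So its values at indicators form a charge dominated by [mu], and the
    Radon-Nikodym theorem gives a density ([normal_functional_density]). Divided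
    by [w], this density is integrable, because the sup-norm bound of [S]
    controls its integral over each level set of [w] by the L1 norm of [g].
    The outcome is [h] in L1 with [pair (S u) g = pair u h] for all bounded
    integrable [u] ([bounded_preadjoint]).

    The extension. Let [u] be bounded by [M] and let [u_n] be its truncation to
    the set where [w > 1 / (n + 1)]. The images of the [u_n] converge almost
    everywhere. Indeed [u_n] is a sum of disjointly supported slices; changing
    signs of slices keeps the bound [M], so the sup-norm bound of [S] shows that
    at almost every point all signed sums of the values of the images of the
    slices are bounded by [M]. Real and imaginary parts of these values then have
    absolutely convergent series ([extension_exists]). The limit [Q u] is bounded
    by [M], and passing to the limit gives [pair (Q u) g = pair u h].

    Bounded classes are separated by L1 ([pair_separated]), so this identity
    alone shows that [Q] is linear and equal to [S] on bounded integrable classes,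
    which glues [S] and [Q] to a linear map on the sum of the two spaces. It also
    says that [duality^~ g] after [Q] is [duality^~ h], which is weak-star
    continuity. Uniqueness holds because the truncations of [u] converge to [u]
    weak-star and lie in L1. *)

Set Implicit Arguments.
Unset Strict Implicit.
Unset Printing Implicit Defensive.

Import Order.TTheory GRing.Theory Num.Theory.
Import numFieldNormedType.Exports.

Local Open Scope classical_set_scope.
Local Open Scope ring_scope.

Local Notation normc := Normc.normc.
Local Notation Re := complex.Re.
Local Notation Im := complex.Im.

(** * Classes of complex measurable functions *)

Section complex_numbers.
Context (R : realType).
Implicit Types z : R[i].

Lemma normc_ge0 z : 0 <= normc z.
Proof. by case: z => ? ?; exact: sqrtr_ge0. Qed.

Lemma normr_Re_le_normc z : `|Re z| <= normc z.
Proof.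
case: z => a b /=; rewrite -sqrtr_sqr ler_wsqrtr// lerDl; exact: sqr_ge0.
Qed.

Lemma normr_Im_le_normc z : `|Im z| <= normc z.
Proof.
case: z => a b /=; rewrite -sqrtr_sqr ler_wsqrtr// lerDr; exact: sqr_ge0.
Qed.

Lemma normc_le_ReIm z : normc z <= `|Re z| + `|Im z|.
Proof.
case: z => a b /=; rewrite -[leRHS]ger0_norm; last exact: addr_ge0.
rewrite -sqrtr_sqr ler_wsqrtr// sqrrD -!normrX !(ger0_norm (sqr_ge0 _)).
by rewrite lerD2r lerDl mulrn_wge0// mulr_ge0.
Qed.

Lemma normc_real (a : R) : normc (Complex a 0) = `|a|.
Proof. by rewrite /= expr0n addr0 sqrtr_sqr. Qed.

End complex_numbers.

Section measurable_classes.
Local Open Scope quotient_scope.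
Context d (T : measurableType d) (R : realType).
Variable mu : {measure set T -> \bar R}.
Implicit Types (u v g h : L0 mu) (F G : T -> R[i]) (M : R).

Lemma L0_ext u v : {ae mu, forall x, L0_fun u x = L0_fun v x} -> u = v.
Proof. by move=> uv; rewrite -[u]reprK -[v]reprK; exact/L0_eqP. Qed.

Lemma L0_funD u v :
  {ae mu, forall x, L0_fun (u + v) x = L0_fun u x + L0_fun v x}.
Proof.
have := L0_fun_linear 1 u v; rewrite scale1r.
by apply: filterS => x ->; rewrite mul1r.
Qed.

Lemma L0_fun0 : {ae mu, forall x, L0_fun (0 : L0 mu) x = 0}.
Proof.
have := L0_funD 0 0; rewrite addr0; apply: filterS => x x0.
by apply: (@addrI _ (L0_fun (0 : L0 mu) x)); rewrite addr0 -x0.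
Qed.

Lemma L0_funZ (a : R[i]) u :
  {ae mu, forall x, L0_fun (a *: u) x = a * L0_fun u x}.
Proof.
have := L0_fun_linear a u 0; rewrite addr0.
by apply: filterS2 L0_fun0 => x -> ->; rewrite addr0.
Qed.

Lemma L0_funB u v :
  {ae mu, forall x, L0_fun (u - v) x = L0_fun u x - L0_fun v x}.
Proof.
apply: filterS2 (L0_funD u (- v)) (L0_funZ (-1) v) => x -> .
by rewrite scaleN1r => ->; rewrite mulN1r.
Qed.

Lemma cmeasurable_L0_fun u : cmeasurable (L0_fun u).
Proof. exact: set_mem (cmfun_subproof (repr u)). Qed.

Lemma measurable_normc F : cmeasurable F ->
  measurable_fun [set: T] (fun x => normc (F x)).
Proof. by move=> /mem_set mF; exact: (normc_measurable (CMFun mF)). Qed.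

Lemma cmeasurableM F G : cmeasurable F -> cmeasurable G ->
  cmeasurable (fun x => F x * G x).
Proof.
move=> [rF iF] [rG iG]; split.
- rewrite (_ : (fun x => _) =
    (fun x => Re (F x) * Re (G x) - Im (F x) * Im (G x))).
    by apply: measurable_funB; exact: measurable_funM.
  by apply/funext => x; case: (F x) (G x) => ? ? [].
- rewrite (_ : (fun x => _) =
    (fun x => Re (F x) * Im (G x) + Im (F x) * Re (G x))).
    by apply: measurable_funD; exact: measurable_funM.
  by apply/funext => x; case: (F x) (G x) => ? ? [].
Qed.

Lemma cmeasurableD F G : cmeasurable F -> cmeasurable G ->
  cmeasurable (fun x => F x + G x).
Proof.
move=> [rF iF] [rG iG]; split.
- rewrite (_ : (fun x => _) = (fun x => Re (F x) + Re (G x))).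
    exact: measurable_funD.
  by apply/funext => x; case: (F x) (G x) => ? ? [].
- rewrite (_ : (fun x => _) = (fun x => Im (F x) + Im (G x))).
    exact: measurable_funD.
  by apply/funext => x; case: (F x) (G x) => ? ? [].
Qed.

Lemma cmeasurable_cst (z : R[i]) : cmeasurable (fun _ : T => z).
Proof. by split; exact: measurable_cst. Qed.

Lemma cmeasurable_real (f : T -> R) : measurable_fun [set: T] f ->
  cmeasurable (fun x => Complex (f x) 0).
Proof. by move=> mf; split => //=; exact: measurable_cst. Qed.

(** Total in [F], with the junk value [0] at non-measurable functions, so that
    classes can be written without carrying measurability proofs. *)
Definition cls F : L0 mu := \pi_(L0 mu) (insubd (0 : cmfunType T R) F).

Lemma L0_fun_cls F : cmeasurable F -> {ae mu, forall x, L0_fun (cls F) x = F x}.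
Proof.
move=> /mem_set mF; apply: filterS (L0_funP mu (insubd 0 F)) => x.
by rewrite /cls => ->; rewrite insubdK.
Qed.

Lemma eq_clsP F u : cmeasurable F ->
  {ae mu, forall x, F x = L0_fun u x} -> cls F = u.
Proof.
by move=> mF Fu; apply: L0_ext; apply: filterS2 (L0_fun_cls mF) Fu => x ->.
Qed.

Lemma clsD F G : cmeasurable F -> cmeasurable G ->
  cls (fun x => F x + G x) = cls F + cls G.
Proof.
move=> mF mG; apply: eq_clsP; first exact: cmeasurableD.
apply: filterS3 (L0_fun_cls mF) (L0_fun_cls mG) (L0_funD (cls F) (cls G)).
by move=> x Fx Gx ->; rewrite Fx Gx.
Qed.

Lemma clsZ (a : R[i]) F : cmeasurable F ->
  cls (fun x => a * F x) = a *: cls F.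
Proof.
move=> mF; apply: eq_clsP; first exact: cmeasurableM (cmeasurable_cst a) mF.
apply: filterS2 (L0_fun_cls mF) (L0_funZ a (cls F)) => x Fx ->.
by rewrite Fx.
Qed.

Definition absn u (x : T) : R := normc (L0_fun u x).

Lemma measurable_absn u : measurable_fun [set: T] (absn u).
Proof. exact: measurable_normc (cmeasurable_L0_fun u). Qed.

Lemma absn_ge0 u x : 0 <= absn u x. Proof. exact: normc_ge0. Qed.

Definition ess_bounded M u := {ae mu, forall x, absn u x <= M}.

Definition cintegrable u := mu.-integrable [set: T] (EFin \o absn u).

Lemma cLnorm1E u : cLnorm 1 u = (\int[mu]_x (absn u x)%:E)%E.
Proof.
by rewrite /cLnorm Lnorm1; apply: eq_integral => x _ /=; rewrite ger0_norm ?absn_ge0.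
Qed.

Lemma cintegrableP u : cintegrable u <-> (\int[mu]_x (absn u x)%:E < +oo)%E.
Proof.
have E : (\int[mu]_x `|(EFin \o absn u) x| = \int[mu]_x (absn u x)%:E)%E.
  by apply: eq_integral => x _ /=; rewrite ger0_norm ?absn_ge0.
split=> [/integrableP[_]|ufin]; first by rewrite E.
apply/integrableP; split; last by rewrite E.
exact/measurable_EFinP/measurable_absn.
Qed.

Lemma mem_cL1P u : (u \in cLp (lexx 1%E)) <-> cintegrable u.
Proof.
split=> [/set_mem/=|/cintegrableP ui]; first by rewrite cLnorm1E => /cintegrableP.
by apply/mem_set => /=; rewrite cLnorm1E.
Qed.

Lemma cLnormy_leP M u : 0 <= M -> (cLnorm +oo u <= M%:E)%E <-> ess_bounded M u.
Proof.
move=> M0; rewrite /cLnorm unlock /Lnorm; case: ifPn => [mu0|].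
  split=> [/ess_supP|uM].
    by apply: filterS => x /=; rewrite lee_fin ger0_norm ?absn_ge0.
  apply/ess_supP; apply: filterS uM => x /=.
  by rewrite lee_fin ger0_norm ?absn_ge0.
rewrite -leNgt measure_le0 => /eqP mu0; split=> // _.
by exists [set: T]; split => //; exact: measurableT.
Qed.

Lemma mem_cLinftyP u : (u \in cLp (leey 1%E)) <->
  exists2 M, 0 <= M & ess_bounded M u.
Proof.
split=> [/set_mem/=/= unoo|[M M0 uM]].
  have u0 : (0 <= cLnorm +oo u)%E by exact: Lnorm_ge0.
  exists (fine (cLnorm +oo u)); first exact: fine_ge0.
  apply/cLnormy_leP; first exact: fine_ge0.
  by rewrite fineK// ge0_fin_numE.
by apply/mem_set => /=; rewrite (le_lt_trans _ (ltry M))//; exact/cLnormy_leP.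
Qed.

Lemma ess_boundedS M M' u : M <= M' -> ess_bounded M u -> ess_bounded M' u.
Proof. by move=> MM'; apply: filterS => x /le_trans; apply. Qed.

Lemma ess_boundedD M M' u v : ess_bounded M u -> ess_bounded M' v ->
  ess_bounded (M + M') (u + v).
Proof.
move=> uM vM; apply: filterS3 uM vM (L0_funD u v) => x uM vM; rewrite /absn => ->.
by rewrite (le_trans (le_normcD _ _))// lerD.
Qed.

Lemma ess_boundedZ M (a : R[i]) u : ess_bounded M u ->
  ess_bounded (normc a * M) (a *: u).
Proof.
move=> uM; apply: filterS2 uM (L0_funZ a u) => x uM; rewrite /absn => ->.
by rewrite Normc.normcM ler_wpM2l// normc_ge0.
Qed.

Lemma ess_boundedB M M' u v : ess_bounded M u -> ess_bounded M' v ->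
  ess_bounded (M + M') (u - v).
Proof.
move=> uM vM; apply: filterS3 uM vM (L0_funB u v) => x uM vM; rewrite /absn => ->.
by rewrite (le_trans (le_normcD _ _))// normcN lerD.
Qed.

Lemma integrable_ae_le (f k : T -> R) : measurable_fun [set: T] f ->
  mu.-integrable [set: T] (EFin \o k) -> {ae mu, forall x, `|f x| <= k x} ->
  mu.-integrable [set: T] (EFin \o f).
Proof.
move=> mf /integrableP[mk kfin] fk; apply/integrableP.
split; first exact/measurable_EFinP.
apply: le_lt_trans kfin; apply: ae_ge0_le_integral => //.
- by apply: measurableT_comp => //; exact/measurable_EFinP.
- exact: measurableT_comp.
by apply: filterS fk => x fk _ /=; rewrite lee_fin (le_trans fk)// ler_norm.
Qed.

Lemma cintegrable_cls_ae F (k : T -> R) : cmeasurable F ->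
  mu.-integrable [set: T] (EFin \o k) -> {ae mu, forall x, normc (F x) <= k x} ->
  cintegrable (cls F).
Proof.
move=> mF ik Fk; apply: integrable_ae_le ik _; first exact: measurable_absn.
apply: filterS2 Fk (L0_fun_cls mF) => x Fk Fx.
by rewrite ger0_norm ?absn_ge0// /absn Fx.
Qed.

Lemma cintegrable_cls F (k : T -> R) : cmeasurable F ->
  mu.-integrable [set: T] (EFin \o k) -> (forall x, normc (F x) <= k x) ->
  cintegrable (cls F).
Proof. by move=> mF ik Fk; apply: cintegrable_cls_ae ik _ => //; exact: aeW. Qed.

Lemma ess_bounded_cls F M : cmeasurable F ->
  (forall x, normc (F x) <= M) -> ess_bounded M (cls F).
Proof. by move=> mF FM; apply: filterS (L0_fun_cls mF) => x; rewrite /absn => ->. Qed.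

End measurable_classes.

(** * The real pairing and its convergence theorems *)

Section pairing.
Context d (T : measurableType d) (R : realType).
Variable mu : {measure set T -> \bar R}.
Implicit Types (u v g h : L0 mu) (F G : T -> R[i]) (M : R).

Lemma eq_Rintegral_ae (f k : T -> R) :
  measurable_fun [set: T] f -> measurable_fun [set: T] k ->
  {ae mu, forall x, f x = k x} -> \int[mu]_x f x = \int[mu]_x k x.
Proof.
move=> mf mk fk; congr fine; apply: ae_eq_integral => //.
- exact/measurable_EFinP.
- exact/measurable_EFinP.
- by apply: filterS fk => x /= -> _.
Qed.

Lemma cvg0_of_le (x : R^nat) (e : (\bar R)^nat) :
  (forall n, `|x n|%:E <= e n)%E -> e @ \oo --> 0%E -> x @ \oo --> (0 : R).
Proof.
move=> xe e0.
have : (fun n => `|x n|%:E) @ \oo --> 0%E.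
  apply: (@squeeze_cvge _ _ _ _ (cst 0%E) _ e) => //; last exact: cvg_cst.
  by apply: nearW => n /=; rewrite lee_fin normr_ge0 xe.
move/fine_cvgP => [_]; exact: (norm_cvg0 (V := R^o)).
Qed.

Lemma cvge0_lt (e : (\bar R)^nat) (eps : R) : 0 < eps -> e @ \oo --> 0%E ->
  \forall n \near \oo, (e n < eps%:E)%E.
Proof.
move=> eps0 /fine_cvgP[efin /cvgrPdist_lt/(_ _ eps0)].
apply: filterS2 efin => n efin.
by rewrite sub0r normrN -[e n]fineK// lte_fin; exact: le_lt_trans (ler_norm _).
Qed.

(** Dominated convergence in the form used to show that a sequence is null. *)
Lemma integral_vanish (f : nat -> T -> R) (k : T -> R) :
  (forall n, measurable_fun [set: T] (f n)) ->
  (forall n x, 0 <= f n x) ->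
  mu.-integrable [set: T] (EFin \o k) ->
  {ae mu, forall x n, f n x <= k x} ->
  {ae mu, forall x, f^~ x @ \oo --> (0 : R)} ->
  (fun n => \int[mu]_x (f n x)%:E)%E @ \oo --> 0%E.
Proof.
move=> mf f0 ik fk fcvg.
have mf' n : measurable_fun [set: T] (EFin \o f n) by exact/measurable_EFinP.
have fcvg' : {ae mu, forall x, setT x -> (EFin \o f n) x @[n --> \oo] --> 0%E}.
  by apply: filterS fcvg => x fx _; apply: cvg_EFin => //; exact: nearW.
have fk' : {ae mu, forall x n, setT x -> (`|(EFin \o f n) x| <= (EFin \o k) x)%E}.
  by apply: filterS fk => x + n _ /= => /(_ n); rewrite lee_fin ger0_norm.
have [_ _] := dominated_convergence measurableT mf' (measurable_cst _) fcvg' ik fk'.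
by rewrite integral0.
Qed.

(** Working with the real part alone turns every limit and every density into a
    real one; [pairZC] recovers the imaginary part of the duality by rotating
    one argument by [- 'i]. *)
Definition pair u g : R := \int[mu]_x Re (L0_fun u x * L0_fun g x).

Lemma measurable_pair u g :
  measurable_fun [set: T] (fun x => Re (L0_fun u x * L0_fun g x)).
Proof.
by have [] := cmeasurableM (cmeasurable_L0_fun u) (cmeasurable_L0_fun g).
Qed.

Lemma measurable_absnM u g :
  measurable_fun [set: T] (fun x => absn u x * absn g x).
Proof. by apply: measurable_funM; exact: measurable_absn. Qed.

Lemma integrable_absnM M u g : ess_bounded M u -> cintegrable g ->
  mu.-integrable [set: T] (EFin \o (fun x => absn u x * absn g x)).
Proof.
move=> uM gi; apply: (@integrable_ae_le _ _ _ mu _ (fun x => M * absn g x)).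
- exact: measurable_absnM.
- exact: (integrableZl measurableT M gi).
- apply: filterS uM => x uM; rewrite ger0_norm ?mulr_ge0 ?absn_ge0//.
  by rewrite ler_wpM2r// absn_ge0.
Qed.

Lemma integrable_pair M u g : ess_bounded M u -> cintegrable g ->
  mu.-integrable [set: T] (EFin \o (fun x => Re (L0_fun u x * L0_fun g x))).
Proof.
move=> uM gi; apply: integrable_ae_le (integrable_absnM uM gi) _.
  exact: measurable_pair.
apply: aeW => x; rewrite (le_trans (normr_Re_le_normc _))//.
by rewrite Normc.normcM.
Qed.

Lemma pair_ae u g (f : T -> R) : measurable_fun [set: T] f ->
  {ae mu, forall x, Re (L0_fun u x * L0_fun g x) = f x} ->
  pair u g = \int[mu]_x f x.
Proof. by move=> mf; apply: eq_Rintegral_ae => //; exact: measurable_pair. Qed.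

Lemma pairD M M' u v g : ess_bounded M u -> ess_bounded M' v ->
  cintegrable g -> pair (u + v) g = pair u g + pair v g.
Proof.
move=> uM vM gi; rewrite -RintegralD//; last 2 first.
- exact: integrable_pair uM gi.
- exact: integrable_pair vM gi.
apply: pair_ae; first by apply: measurable_funD; exact: measurable_pair.
apply: filterS (L0_funD u v) => x ->; rewrite mulrDl.
by case: (_ * _) (L0_fun v x * _) => ? ? [].
Qed.

Lemma pairZ M (a : R) u g : ess_bounded M u -> cintegrable g ->
  pair (Complex a 0 *: u) g = a * pair u g.
Proof.
move=> uM gi; rewrite -RintegralZl//; last exact: integrable_pair uM gi.
apply: pair_ae; first by apply: measurable_funM => //; exact: measurable_pair.
apply: filterS (L0_funZ (Complex a 0) u) => x ->; rewrite -mulrA.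
by case: (L0_fun u x * _) => b c /=; rewrite mul0r subr0.
Qed.

Lemma pairB M M' u v g : ess_bounded M u -> ess_bounded M' v ->
  cintegrable g -> pair (u - v) g = pair u g - pair v g.
Proof.
move=> uM vM gi; rewrite -RintegralB//; last 2 first.
- exact: integrable_pair uM gi.
- exact: integrable_pair vM gi.
apply: pair_ae; first by apply: measurable_funB; exact: measurable_pair.
apply: filterS (L0_funB u v) => x ->; rewrite mulrBl.
by case: (_ * _) (L0_fun v x * _) => ? ? [].
Qed.

Lemma pairZC (a : R[i]) u g : pair (a *: u) g = pair u (a *: g).
Proof.
apply: pair_ae; first exact: measurable_pair.
apply: filterS2 (L0_funZ a u) (L0_funZ a g) => x -> ->.
by rewrite mulrCA mulrA.
Qed.

Lemma normr_pair_le M u g : ess_bounded M u -> cintegrable g ->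
  (`|pair u g|%:E <= \int[mu]_x (absn u x * absn g x)%:E)%E.
Proof.
move=> uM gi; rewrite EFin_normr_Rintegral//; last exact: integrable_pair uM gi.
apply: le_trans (le_abse_integral mu measurableT _) _.
  exact/measurable_EFinP/measurable_pair.
apply: ge0_le_integral => //.
- by apply: measurableT_comp => //; exact/measurable_EFinP/measurable_pair.
- exact/measurable_EFinP/measurable_absnM.
move=> x _ /=; rewrite lee_fin (le_trans (normr_Re_le_normc _))//.
by rewrite Normc.normcM.
Qed.

Lemma ess_bounded_nat M (u : nat -> L0 mu) : (forall n, ess_bounded M (u n)) ->
  {ae mu, forall x n, absn (u n) x <= M}.
Proof. by move=> uM; exact/ae_foralln. Qed.

(** Dominated convergence, with a multiple of [absn g] as dominating function. *)
Lemma pair_cvg M (u : nat -> L0 mu) v g :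
  (forall n, ess_bounded M (u n)) -> ess_bounded M v -> cintegrable g ->
  {ae mu, forall x, (fun n => normc (L0_fun (u n) x - L0_fun v x)) @ \oo --> (0 : R)} ->
  (fun n => pair (u n) g) @ \oo --> pair v g.
Proof.
move=> uM vM gi uv.
have bM n := ess_boundedB (uM n) vM.
apply/(subr_cvg0 (V := R^o)).
under eq_fun do rewrite -(pairB (uM _) vM gi).
apply: cvg0_of_le (fun n => normr_pair_le (bM n) gi) _.
apply: (@integral_vanish _ (fun x => (M + M) * absn g x)).
- by move=> n; exact: measurable_absnM.
- by move=> n x; rewrite mulr_ge0// absn_ge0.
- exact: (integrableZl measurableT _ gi).
- apply: filterS (ess_bounded_nat bM) => x + n => /(_ n) h.
  by rewrite ler_wpM2r// absn_ge0.
have uvB : {ae mu, forall x n,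
    L0_fun (u n - v) x = L0_fun (u n) x - L0_fun v x}.
  by apply/ae_foralln => n; exact: L0_funB.
apply: filterS2 uv uvB => x uvx uvB.
rewrite -[X in _ --> X](mul0r (absn g x)); apply: cvgMl => /=.
by under eq_fun do rewrite /absn uvB.
Qed.

(** Cut [g] at a level [K]: below it the pairing is at most [K] times the L1 norm
    of [u n], above it at most [M] times the integral of the tail of [g],
    uniformly in [n]. *)
Lemma pair_cvg0_L1 M (u : nat -> L0 mu) g :
  (forall n, ess_bounded M (u n)) -> cintegrable g ->
  (fun n => \int[mu]_x (absn (u n) x)%:E)%E @ \oo --> 0%E ->
  (fun n => pair (u n) g) @ \oo --> (0 : R).
Proof.
move=> uM gi u0.
pose tail (K : nat) x := `|M| * (absn g x * \1_[set y | K%:R < absn g y] x).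
have mtail K : measurable_fun [set: T] (tail K).
  apply: measurable_funM => //; apply: measurable_funM; first exact: measurable_absn.
  apply: measurable_indic; rewrite -[X in measurable X]setTI.
  by apply: measurable_fun_ltr => //; exact: measurable_absn.
have tail_ge0 K x : 0 <= tail K x by rewrite !mulr_ge0// absn_ge0.
have tail_cvg : (fun K => \int[mu]_x (tail K x)%:E)%E @ \oo --> 0%E.
  apply: (@integral_vanish _ (fun x => `|M| * absn g x)) => //.
  - exact: (integrableZl measurableT _ gi).
  - apply: aeW => x K; rewrite ler_wpM2l// ler_piMr ?absn_ge0//.
  - apply: aeW => x; apply: cvg_near_cst; near=> K.
    rewrite /tail indicE memNset ?mulr0//=; apply/negP; rewrite -leNgt.
    by near: K; exact: nbhs_infty_ger.
have split_bound K n : (`|pair (u n) g|%:E <=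
    K%:R%:E * \int[mu]_x (absn (u n) x)%:E + \int[mu]_x (tail K x)%:E)%E.
  apply: le_trans (normr_pair_le (uM n) gi) _.
  rewrite -ge0_integralZl//; last 2 first.
  - exact/measurable_EFinP/measurable_absn.
  - by move=> x _; rewrite lee_fin absn_ge0.
  rewrite -ge0_integralD//; last 4 first.
  - by move=> x _; rewrite mule_ge0// lee_fin absn_ge0.
  - by apply/measurable_EFinP/measurable_funM => //; exact: measurable_absn.
  - by move=> x _; rewrite lee_fin.
  - exact/measurable_EFinP.
  apply: ae_ge0_le_integral => //.
  - by move=> x _; rewrite lee_fin mulr_ge0// absn_ge0.
  - exact/measurable_EFinP/measurable_absnM.
  - by move=> x _; rewrite -EFinM -EFinD lee_fin addr_ge0// mulr_ge0// absn_ge0.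
  - apply/measurable_EFinP/measurable_funD => //.
    by apply: measurable_funM => //; exact: measurable_absn.
  apply: filterS (uM n) => x ux _; rewrite -EFinM -EFinD lee_fin /tail indicE.
  have [Kg|gK] := ltP K%:R (absn g x).
    rewrite mem_set//= mulr1 (@le_trans _ _ (`|M| * absn g x))//.
      by rewrite ler_wpM2r ?absn_ge0// (le_trans ux)// ler_norm.
    by rewrite lerDr mulr_ge0// absn_ge0.
  rewrite memNset/=; last by apply/negP; rewrite -leNgt.
  by rewrite !mulr0 addr0 mulrC ler_wpM2r// absn_ge0.
apply/cvgr0Pnorm_lt => eps eps0.
have eps2 : 0 < eps / 2 by rewrite divr_gt0.
have [K _ /(_ K (leqnn K)) tailK] := cvge0_lt eps2 tail_cvg.
have e0 : 0 < eps / 2 / K.+1%:R by rewrite divr_gt0.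
apply: filterS (cvge0_lt e0 u0) => n un.
rewrite -lte_fin (le_lt_trans (split_bound K n))//.
rewrite (splitr eps) EFinD; apply: lee_ltD => //.
  rewrite fin_numM// ge0_fin_numE ?(lt_trans un) ?ltry//.
  by apply: integral_ge0 => x _; rewrite lee_fin absn_ge0.
apply: (@le_trans _ _ (K.+1%:R%:E * (eps / 2 / K.+1%:R)%:E)%E).
  apply: lee_pmul => //; last exact: ltW.
    by apply: integral_ge0 => x _; rewrite lee_fin absn_ge0.
  by rewrite lee_fin ler_nat.
by rewrite -EFinM mulrC divfK.
Unshelve. all: by end_near. Qed.

End pairing.

(** * Integrable weights and operators on classes *)

Section sigma_finite_weight.
Context d (T : measurableType d) (R : realType).
Variable mu : {measure set T -> \bar R}.

(** The weight is a sum of indicators of a finite-measure cover, each one scaled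
    down geometrically and by the measure of its set. It replaces the cover: its
    level sets exhaust the space, and a bound by a multiple of [w] gives
    integrability and essential boundedness together. *)
Lemma sigma_finite_weight : sigma_finite [set: T] mu ->
  exists w : T -> R, [/\ measurable_fun [set: T] w, forall x, 0 < w x,
    forall x, w x <= 1 & mu.-integrable [set: T] (EFin \o w)].
Proof.
move=> [F FT mF].
pose c n : R := 1 / (2 ^ n.+1)%:R / (1 + fine (mu (F n))).
have den_gt0 n : 0 < 1 + fine (mu (F n)) by rewrite ltr_pwDl// fine_ge0.
have c_gt0 n : 0 < c n by rewrite !divr_gt0// ltr0n expn_gt0.
have c_le n : c n <= 1 / (2 ^ n.+1)%:R.
  by rewrite ler_pdivrMr// ler_peMr ?divr_ge0// lerDl fine_ge0.
pose t n x : \bar R := (c n * \1_(F n) x)%:E.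
have t_ge0 n x : (0 <= t n x)%E by rewrite lee_fin mulr_ge0// ltW.
have mt n : measurable_fun [set: T] (t n).
  apply/measurable_EFinP/measurable_funM => //.
  by apply: measurable_indic; have [] := mF n.
have sum_c : (\sum_(n <oo) (1 / (2 ^ n.+1)%:R : R)%:E <= 1)%E.
  exact: epsilon_trick0.
have t_le x : (\sum_(n <oo) t n x <= 1)%E.
  apply: le_trans sum_c; apply: lee_nneseries => // n _.
  rewrite lee_fin (le_trans _ (c_le n))// ler_piMr//.
  exact: ltW.
have t_fin x : (\sum_(n <oo) t n x)%E \is a fin_num.
  by rewrite ge0_fin_numE ?(le_lt_trans (t_le x)) ?ltry// nneseries_ge0.
have mW : measurable_fun [set: T] (fun x => \sum_(n <oo) t n x)%E.
  have := @ge0_emeasurable_sum _ _ _ setT t xpredT.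
  by apply => // *; exact: t_ge0.
exists (fun x => fine (\sum_(n <oo) t n x)%E); split.
- exact: (measurableT_comp _ mW).
- move=> x; have [n _ Fnx] : (\bigcup_i F i) x by rewrite -FT.
  apply: (@lt_le_trans _ _ (c n)) => //; rewrite -lee_fin fineK//.
  have : (t n x <= \sum_(0 <= i < n.+1) t i x)%E.
    by rewrite big_nat_recr//= leeDr// sume_ge0.
  rewrite {1}/t indicE mem_set// mulr1 => /le_trans; apply.
  exact: nneseries_lim_ge.
- by move=> x; rewrite -lee_fin fineK.
- apply/integrableP; split.
    exact/measurable_EFinP/(measurableT_comp _ mW).
  rewrite (eq_integral (fun x => \sum_(n <oo) t n x)%E); last first.
    by move=> x _ /=; rewrite ger0_norm ?fineK ?fine_ge0 ?nneseries_ge0.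
  rewrite integral_nneseries//; apply: le_lt_trans (ltry 1).
  apply: le_trans sum_c; apply: lee_nneseries => [n _ _|n _].
    exact: integral_ge0.
  have [mFn Fnfin] := mF n.
  rewrite /t; under eq_integral do rewrite EFinM.
  rewrite ge0_integralZl//; last 2 first.
  - by apply/measurable_EFinP; exact: measurable_indic.
  - by rewrite lee_fin ltW.
  rewrite integral_indic// setIT -[mu (F n)]fineK ?ge0_fin_numE//.
  rewrite -EFinM lee_fin /c -[leLHS]mulrA ler_piMr ?divr_ge0//.
  by rewrite mulrC ler_pdivrMr// mul1r lerDr.
Qed.

End sigma_finite_weight.

Section dunford_schwartz_operator.
Context d (T : measurableType d) (R : realType).
Variable mu : {measure set T -> \bar R}.
Variables (S : {linear L1 mu -> L1 mu}) (S_ds : dunford_schwartz S).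
Implicit Types (u v g h : L0 mu) (F G : T -> R[i]) (M : R).

(** [S] on classes, with the junk value [0] outside L1. This spares the casts
    between L1, L-infinity and [L0]. *)
Definition class_op u : L0 mu := val (S (insubd 0 u)).

Local Notation op := class_op.

Lemma opE (f : L1 mu) : op (val f) = val (S f).
Proof. by rewrite /class_op valKd. Qed.

Lemma cintegrableD u v : cintegrable u -> cintegrable v -> cintegrable (u + v).
Proof. by move=> /mem_cL1P ui /mem_cL1P vi; apply/mem_cL1P; exact: rpredD. Qed.

Lemma cintegrableZ (a : R[i]) u : cintegrable u -> cintegrable (a *: u).
Proof. by move=> /mem_cL1P ui; apply/mem_cL1P; exact: rpredZ. Qed.

Lemma cintegrableB u v : cintegrable u -> cintegrable v -> cintegrable (u - v).
Proof. by move=> /mem_cL1P ui /mem_cL1P vi; apply/mem_cL1P; exact: rpredB. Qed.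

Lemma opD u v : cintegrable u -> cintegrable v -> op (u + v) = op u + op v.
Proof.
move=> /mem_cL1P ui /mem_cL1P vi.
rewrite -[LHS]/(op (val (CLp ui + CLp vi))) opE linearD.
exact: congr2 (esym (opE (CLp ui))) (esym (opE (CLp vi))).
Qed.

Lemma opZ (a : R[i]) u : cintegrable u -> op (a *: u) = a *: op u.
Proof.
move=> /mem_cL1P ui.
rewrite -[LHS]/(op (val (a *: CLp ui))) opE linearZ.
exact: congr1 (esym (opE (CLp ui))).
Qed.

Lemma opB u v : cintegrable u -> cintegrable v -> op (u - v) = op u - op v.
Proof.
move=> ui vi; rewrite -scaleN1r opD//; last exact: cintegrableZ.
by rewrite opZ// scaleN1r.
Qed.

Lemma op_sum (I : Type) (r : seq I) (u : I -> L0 mu) :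
  (forall i, cintegrable (u i)) ->
  cintegrable (\sum_(i <- r) u i) /\
  op (\sum_(i <- r) u i) = \sum_(i <- r) op (u i).
Proof.
move=> ui; elim: r => [|i r [ri IH]].
  rewrite !big_nil; split; first by apply/mem_cL1P; exact: rpred0.
  rewrite -[LHS]/(op (val (0 : L1 mu))) opE.
  by rewrite [S 0]linear0.
by rewrite !big_cons opD// IH; split => //; exact: cintegrableD.
Qed.

Lemma le_integral_op u : cintegrable u ->
  (\int[mu]_x (absn (op u) x)%:E <= \int[mu]_x (absn u x)%:E)%E.
Proof.
move=> /mem_cL1P ui; have := S_ds.1 (CLp ui).
by rewrite -[X in cLnorm _ X]opE !cLnorm1E.
Qed.

Lemma ess_bounded_op M u : 0 <= M -> cintegrable u -> ess_bounded M u ->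
  ess_bounded M (op u).
Proof.
move=> M0 /mem_cL1P ui uM.
have uoo : val (CLp ui) \in cLp (leey 1%E) by apply/mem_cLinftyP; exists M.
have := S_ds.2 (CLp ui) uoo; rewrite -[X in cLnorm _ X]opE => uS.
by apply/(cLnormy_leP _ M0)/(le_trans uS)/cLnormy_leP.
Qed.

(** The continuity of [S] behind the pre-adjoint. Dominated convergence gives
    convergence in L1, which [S] preserves by its L1 bound; the images stay
    bounded by its sup-norm bound, so [pair_cvg0_L1] allows an unbounded [g]. *)
Lemma pair_op_cvg M (k : T -> R) (F_ : nat -> T -> R[i]) F g :
  0 <= M ->
  (forall n, cmeasurable (F_ n)) -> cmeasurable F ->
  mu.-integrable [set: T] (EFin \o k) -> (forall x, k x <= M) ->
  (forall n x, normc (F_ n x) <= k x) -> (forall x, normc (F x) <= k x) ->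
  (forall x, (fun n => normc (F_ n x - F x)) @ \oo --> (0 : R)) ->
  cintegrable g ->
  (fun n => pair (op (cls mu (F_ n))) g) @ \oo --> pair (op (cls mu F)) g.
Proof.
move=> M0 mF_ mF ik kM Fk_ Fk FF gi.
have iF_ n : cintegrable (cls mu (F_ n)) by exact: cintegrable_cls ik (Fk_ n).
have iF : cintegrable (cls mu F) by exact: cintegrable_cls ik Fk.
have bF_ n : ess_bounded M (op (cls mu (F_ n))).
  apply: ess_bounded_op => //; apply: ess_bounded_cls => // x.
  exact: le_trans (Fk_ n x) (kM x).
have bF : ess_bounded M (op (cls mu F)).
  apply: ess_bounded_op => //; apply: ess_bounded_cls => // x.
  exact: le_trans (Fk x) (kM x).
apply/(subr_cvg0 (V := R^o)).
under eq_fun do rewrite -(pairB (bF_ _) bF gi) -opB//.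
apply: (@pair_cvg0_L1 _ _ _ _ (M + M)) => //.
  by move=> n; rewrite opB//; exact: ess_boundedB.
have FnF n : {ae mu, forall x,
    absn (cls mu (F_ n) - cls mu F) x = normc (F_ n x - F x)}.
  apply: filterS3 (L0_funB (cls mu (F_ n)) (cls mu F)) (L0_fun_cls mu (mF_ n))
    (L0_fun_cls mu mF) => x.
  by rewrite /absn => -> -> ->.
apply: (@squeeze_cvge _ _ _ _ (cst 0%E) _
  (fun n => \int[mu]_x (absn (cls mu (F_ n) - cls mu F) x)%:E)%E).
- apply: nearW => n; rewrite le_integral_op ?andbT; last exact: cintegrableB.
  by apply: integral_ge0 => x _; rewrite lee_fin absn_ge0.
- exact: cvg_cst.
apply: (@integral_vanish _ _ _ _ _ (fun x => 2 * k x)).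
- by move=> n; exact: measurable_absn.
- by move=> n x; exact: absn_ge0.
- exact: (integrableZl measurableT _ ik).
- apply/ae_foralln => n; apply: filterS (FnF n) => x ->.
  by rewrite (le_trans (le_normcD _ _))// normcN mulr2n mulrDl mul1r lerD.
- have FnF' : {ae mu, forall x n,
      absn (cls mu (F_ n) - cls mu F) x = normc (F_ n x - F x)}.
    exact/ae_foralln.
  by apply: filterS FnF' => x Fx; under eq_fun do rewrite Fx; exact: FF.
Qed.

End dunford_schwartz_operator.

(** * Normal functionals on bounded measurable functions *)

Import HBSimple HBNNSimple.

Section bounded_functional_density.
Context d (T : measurableType d) (R : realType).
Variable mu : {measure set T -> \bar R}.
Hypothesis mu_sigma_finite : sigma_finite [set: T] mu.

Definition bounded_measurable (f : T -> R) :=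
  measurable_fun [set: T] f /\ exists M, forall x, `|f x| <= M.

Lemma bounded_measurableD f g : bounded_measurable f -> bounded_measurable g ->
  bounded_measurable (fun x => f x + g x).
Proof.
move=> [mf [M fM]] [mg [M' gM]]; split; first exact: measurable_funD.
by exists (M + M') => x; rewrite (le_trans (ler_normD _ _))// lerD.
Qed.

Lemma bounded_measurableM f g : bounded_measurable f -> bounded_measurable g ->
  bounded_measurable (fun x => f x * g x).
Proof.
move=> [mf [M fM]] [mg [M' gM]]; split; first exact: measurable_funM.
by exists (M * M') => x; rewrite normrM ler_pM.
Qed.

Lemma bounded_measurable_cst (a : R) : bounded_measurable (fun=> a).
Proof. by split; [exact: measurable_cst|exists `|a|]. Qed.

Lemma bounded_measurable_indic (A : set T) : measurable A ->
  bounded_measurable \1_A.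
Proof.
move=> mA; split; first exact: measurable_indic.
by exists 1 => x; rewrite ger0_norm.
Qed.

Lemma bounded_measurable_sum n (a : 'I_n -> R) (f : 'I_n -> T -> R) :
  (forall i, bounded_measurable (f i)) ->
  bounded_measurable (fun x => \sum_(i < n) a i * f i x).
Proof.
move=> bf; elim: n => [|n IH] in a f bf *.
  under eq_fun do rewrite big_ord0; exact: bounded_measurable_cst.
under eq_fun do rewrite big_ord_recr/=; apply: bounded_measurableD.
  apply: (IH (a \o widen_ord (leqnSn n)) (f \o widen_ord (leqnSn n))) => i.
  exact: bf.
by apply: bounded_measurableM => //; exact: bounded_measurable_cst.
Qed.

(** The third clause is the functional form of countable additivity: bounded
    pointwise convergence covers both the partial sums of a disjoint family of
    indicators and the approximation by simple functions. *)
Record normal_functional (phi : (T -> R) -> R) : Prop := NormalFunctional {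
  normalD : forall f g, bounded_measurable f -> bounded_measurable g ->
    phi (fun x => f x + g x) = phi f + phi g ;
  normalZ : forall (a : R) f, bounded_measurable f ->
    phi (fun x => a * f x) = a * phi f ;
  normal_cvg : forall (M : R) (f_ : nat -> T -> R) (f : T -> R),
    (forall n, measurable_fun [set: T] (f_ n)) -> measurable_fun [set: T] f ->
    (forall n x, `|f_ n x| <= M) -> (forall x, `|f x| <= M) ->
    (forall x, f_ ^~ x @ \oo --> f x) -> (fun n => phi (f_ n)) @ \oo --> phi f }.

Lemma normal_functional_sum phi n (a : 'I_n -> R) (f : 'I_n -> T -> R) :
  normal_functional phi -> (forall i, bounded_measurable (f i)) ->
  phi (fun x => \sum_(i < n) a i * f i x) = \sum_(i < n) a i * phi (f i).
Proof.
move=> nphi bf; elim: n => [|n IH] in a f bf *.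
  rewrite big_ord0; under eq_fun do rewrite big_ord0.
  have := normalZ nphi 0 (bounded_measurable_cst 0).
  by under eq_fun do rewrite mul0r; rewrite mul0r.
rewrite big_ord_recr/=; under eq_fun do rewrite big_ord_recr/=.
have bw i : bounded_measurable ((f \o widen_ord (leqnSn n)) i) by exact: bf.
rewrite normalD//; last 2 first.
- exact: (bounded_measurable_sum (a \o widen_ord (leqnSn n)) bw).
- by apply: bounded_measurableM => //; exact: bounded_measurable_cst.
by rewrite (IH (a \o widen_ord (leqnSn n)))//= normalZ.
Qed.

(** Simple functions approximate nonnegative bounded functions from below. *)
Lemma eq_normal_functional phi psi :
  normal_functional phi -> normal_functional psi ->
  (forall A, measurable A -> phi \1_A = psi \1_A) ->
  forall f, bounded_measurable f -> phi f = psi f.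
Proof.
move=> nphi npsi phipsi.
(* Adding the constant [M] makes a function bounded by [M] nonnegative. *)
suff pos f : bounded_measurable f -> (forall x, 0 <= f x) -> phi f = psi f.
  move=> f bf; have [mf [M fM]] := bf.
  have bM := bounded_measurable_cst M.
  have b1 : bounded_measurable (\1_[set: T] : T -> R).
    exact: bounded_measurable_indic.
  have fE : f = fun x => (f x + M) + (- M) * \1_[set: T] x.
    by apply/funext => x; rewrite indicT/= mulr1 addrK.
  have bfM : bounded_measurable (fun x => f x + M) by exact: bounded_measurableD.
  have bM1 : bounded_measurable (fun x => (- M) * \1_[set: T] x).
    by apply: bounded_measurableM => //; exact: bounded_measurable_cst.
  rewrite fE (normalD nphi)// (normalD npsi)//.
  rewrite (normalZ nphi)// (normalZ npsi)// phipsi// pos// => x.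
  by rewrite -lerBlDr sub0r; have := fM x; rewrite ler_norml => /andP[].
move=> bf f0; have [mf [M fM]] := bf.
have mEf : measurable_fun [set: T] (EFin \o f) by exact/measurable_EFinP.
pose s n := nnsfun_approx measurableT mEf n.
have s_le n x : `|s n x| <= M.
  rewrite ger0_norm// (le_trans _ (fM x))// ger0_norm//.
  by rewrite -lee_fin /s nnsfun_approxE le_approx// => y _ /=; rewrite lee_fin.
have s_cvg x : s ^~ x @ \oo --> f x.
  have := @cvg_nnsfun_approx _ _ _ _ measurableT _ mEf (fun x _ => f0 x) x Logic.I.
  by move/fine_cvgP => -[].
have ms n : measurable_fun [set: T] (s n) by exact: measurable_funP.
have cphi := normal_cvg nphi ms mf s_le fM s_cvg.
have cpsi := normal_cvg npsi ms mf s_le fM s_cvg.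
have E n : phi (s n) = psi (s n).
  have mp (i : R) : measurable (s n @^-1` [set i]).
    by rewrite -[X in measurable X]setTI; exact: ms.
  rewrite (funext (fimfunEord (s n))).
  have bi i : bounded_measurable (\1_(s n @^-1` [set i]) : T -> R).
    exact: bounded_measurable_indic.
  rewrite !normal_functional_sum//; apply: eq_bigr => i _; congr (_ * _).
  exact: phipsi.
apply: (cvg_unique _ cphi); first exact: (@norm_hausdorff R R^o).
by apply: cvg_trans cpsi; apply: near_eq_cvg; apply: nearW => n; rewrite E.
Qed.

Lemma integrable_bounded_mul f (rho : T -> R) : bounded_measurable f ->
  measurable_fun [set: T] rho -> mu.-integrable [set: T] (EFin \o rho) ->
  mu.-integrable [set: T] (EFin \o (fun x => f x * rho x)).
Proof.
move=> [mf [M fM]] mrho irho.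
apply: (@integrable_ae_le _ _ _ _ _ (fun x => M * `|rho x|)).
- exact: measurable_funM.
- exact: (integrableZl measurableT M (integrable_norm irho)).
- by apply: aeW => x; rewrite normrM ler_wpM2r.
Qed.

Lemma normal_functional_integral (rho : T -> R) : measurable_fun [set: T] rho ->
  mu.-integrable [set: T] (EFin \o rho) ->
  normal_functional (fun f => \int[mu]_x (f x * rho x)).
Proof.
move=> mrho irho; split=> [f g bf bg|a f bf|M f_ f mf_ mf f_M fM f_f].
- rewrite -RintegralD//; try exact: integrable_bounded_mul.
  by under eq_Rintegral do rewrite mulrDl.
- rewrite -RintegralZl//; last exact: integrable_bounded_mul.
  by under eq_Rintegral do rewrite -mulrA.
have m_ n : measurable_fun [set: T] (EFin \o (fun x => f_ n x * rho x)).
  by apply/measurable_EFinP; exact: measurable_funM.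
have m : measurable_fun [set: T] (EFin \o (fun x => f x * rho x)).
  by apply/measurable_EFinP; exact: measurable_funM.
have c : {ae mu, forall x, setT x ->
    (EFin \o (fun x => f_ n x * rho x)) x @[n --> \oo] --> (f x * rho x)%:E}.
  apply: aeW => x _; apply: cvg_EFin; first exact: nearW.
  by apply: (@cvgMl R); exact: f_f.
have dom : {ae mu, forall x n, setT x ->
    (`|(EFin \o (fun x => (f_ n x * rho x)%R)) x| <= (M * `|rho x|)%:E)%E}.
  by apply: aeW => x n _ /=; rewrite lee_fin normrM ler_wpM2r.
have idom := integrableZl measurableT M (integrable_norm irho).
have [_ _] := dominated_convergence measurableT m_ m c idom dom.
rewrite -[X in _ --> X -> _]fineK; first by move/fine_cvgP => [].
apply: integrable_fin_num => //; apply: integrable_bounded_mul => //.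
by split => //; exists M.
Qed.

Section density.
Variables (phi : (T -> R) -> R) (nphi : normal_functional phi).
Hypothesis phi_null : forall A, measurable A -> mu A = 0%E -> phi \1_A = 0.

Definition indic_charge (A : set T) : \bar R := (phi \1_A)%:E.

Let indic_charge0 : indic_charge set0 = 0%E.
Proof. by rewrite /indic_charge phi_null// measure0. Qed.

Let indic_charge_fin A : measurable A -> indic_charge A \is a fin_num.
Proof. by []. Qed.

Let indic_charge_sigma_additive : semi_sigma_additive indic_charge.
Proof.
move=> F mF tF mUF.
pose f n x : R := \sum_(i < n) 1 * \1_(F i) x.
have bF i : bounded_measurable (\1_(F i) : T -> R).
  exact: bounded_measurable_indic.
have bf n : bounded_measurable (f n) by exact: bounded_measurable_sum.
have phif n : phi (f n) = \sum_(i < n) phi \1_(F i).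
  rewrite [LHS](normal_functional_sum (fun=> 1) nphi)//.
  by apply: eq_bigr => i _; rewrite mul1r.
have fE n x : (f n x)%:E = (\sum_(0 <= i < n) (\1_(F i) x : R)%:E)%E.
  by rewrite big_mkord sumEFin; congr EFin; apply: eq_bigr => i _; rewrite mul1r.
have f_ge0 n x : 0 <= f n x by apply: sumr_ge0 => i _; rewrite mul1r.
have f_cvg x : f ^~ x @ \oo --> (\1_(\bigcup_n F n) x : R).
  suff /fine_cvgP[] : (EFin \o f ^~ x) @ \oo --> (\1_(\bigcup_n F n) x : R)%:E by [].
  rewrite indic_bigcup//.
  rewrite (_ : _ \o _ = fun n => \sum_(0 <= i < n) (\1_(F i) x : R)%:E)%E.
    exact: is_cvg_nneseries.
  by apply/funext => n; rewrite -fE.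
have f_le n x : `|f n x| <= 1.
  rewrite ger0_norm// -lee_fin fE.
  apply: (@le_trans _ _ (\sum_(0 <= i <oo) (\1_(F i) x : R)%:E)%E).
    exact: nneseries_lim_ge.
  by rewrite -indic_bigcup// lee_fin /indic lern1 leq_b1.
have U_le x : `|\1_(\bigcup_n F n) x : R| <= 1.
  by rewrite ger0_norm.
have m1U : measurable_fun [set: T] (\1_(\bigcup_n F n) : T -> R).
  exact: measurable_indic.
have := normal_cvg nphi (fun n => (bf n).1) m1U f_le U_le f_cvg.
move=> /(cvg_EFin (f := fun n => (phi (f n))%:E) (nearW _ (fun=> isT))).
rewrite /indic_charge; apply: cvg_trans; apply: near_eq_cvg.
by apply: nearW => n /=; rewrite phif big_mkord sumEFin.
Qed.

HB.instance Definition _ := isCharge.Build _ _ _ indic_charge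
  indic_charge0 indic_charge_fin indic_charge_sigma_additive.

(** The values at indicators form a charge which [mu] dominates, and the functional
    is integration against its Radon-Nikodym density, since both are normal and
    agree on indicators. *)
Lemma normal_functional_density : exists rho : T -> R,
  [/\ measurable_fun [set: T] rho, mu.-integrable [set: T] (EFin \o rho) &
  forall f, bounded_measurable f -> phi f = \int[mu]_x (f x * rho x)].
Proof.
pose H1 := isSFinite.Build _ _ _ _ (sfinite_measure_sigma_finite mu_sigma_finite).
pose H2 := isSigmaFinite.Build _ _ _ _ mu_sigma_finite.
pose mu' := HB.pack_for (SigmaFiniteMeasure.type T R) (Measure.sort mu) H1 H2.
have dom : indic_charge `<< mu'.
  by apply/null_content_dominatesP => A mA A0; rewrite /indic_charge phi_null.
pose D := Radon_Nikodym (indic_charge : {charge set T -> \bar R}) mu'.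
have iD : mu.-integrable [set: T] D by exact: (Radon_Nikodym_integrable dom).
have DE : EFin \o (fine \o D) = D.
  by apply/funext => x /=; rewrite fineK//; exact: (Radon_Nikodym_fin_num x dom).
have iD' : mu.-integrable [set: T] (EFin \o (fine \o D)) by rewrite DE.
have mD : measurable_fun [set: T] (fine \o D).
  by apply: measurableT_comp => //; exact: measurable_int iD.
exists (fine \o D); split => //.
apply: (eq_normal_functional nphi (normal_functional_integral mD iD')) => A mA.
apply: EFin_inj; rewrite -[LHS]/(indic_charge A).
rewrite [LHS](Radon_Nikodym_integral dom mA) -/D -[in LHS]DE.
rewrite integral_mkcond -[LHS]fineK; last first.
  apply: integrable_fin_num => //; apply/(integrable_mkcond _ mA).
  exact: integrableS iD'.
congr (fine _)%:E; apply: eq_integral => x _.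
by rewrite patchE indicE; case: ifP => _ /=; rewrite ?mul1r ?mul0r.
Qed.
End density.

End bounded_functional_density.

(** * The pre-adjoint *)

Section bounded_preadjoint.
Context d (T : measurableType d) (R : realType).
Variable mu : {measure set T -> \bar R}.
Hypothesis mu_sigma_finite : sigma_finite [set: T] mu.
Variables (S : {linear L1 mu -> L1 mu}) (S_ds : dunford_schwartz S).
Variable w : T -> R.
Hypotheses (mw : measurable_fun [set: T] w) (w_gt0 : forall x, 0 < w x)
  (w_le1 : forall x, w x <= 1) (w_int : mu.-integrable [set: T] (EFin \o w)).
Implicit Types (u v g h : L0 mu) (F G : T -> R[i]) (M : R) (f : T -> R).

Local Notation op := (class_op S).

(** The threshold at [0] is [1], so that the level set [0] is empty as soon as
    [w] is at most [1]; this starts the telescoping of [sum_slice]. *)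
Definition level (n : nat) : set T := [set x | n.+1%:R^-1 < w x].

Lemma measurable_level n : measurable (level n).
Proof.
rewrite -[X in measurable X]setTI.
by apply: (measurable_fun_ltr (f := cst n.+1%:R^-1)).
Qed.

Lemma level_cvg x : \forall n \near \oo, level n x.
Proof.
have := near_infty_natSinv_lt (PosNum (w_gt0 x)).
by apply: filterS => n.
Qed.

Lemma indic_level_cvg x : \1_(level n) x @[n --> \oo] --> (1 : R).
Proof.
apply: cvg_near_cst; apply: filterS (level_cvg x) => n xn.
by rewrite indicE mem_set.
Qed.

Lemma cls_real_bound M f : measurable_fun [set: T] f ->
  (forall x, `|f x| <= M) ->
  [/\ cmeasurable (fun x => Complex (w x * f x) 0),
      forall x, normc (Complex (w x * f x) 0) <= M * w x,
      cintegrable (cls mu (fun x => Complex (w x * f x) 0)) &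
      0 <= M -> ess_bounded M (op (cls mu (fun x => Complex (w x * f x) 0)))].
Proof.
move=> mf fM; pose F x := Complex (w x * f x) 0.
have mF : cmeasurable F by apply: cmeasurable_real; exact: measurable_funM.
have FMw x : normc (F x) <= M * w x.
  rewrite /F normc_real normrM (gtr0_norm (w_gt0 x)) mulrC.
  by rewrite ler_wpM2r// ltW.
have Fi : cintegrable (cls mu F).
  exact: cintegrable_cls mF (integrableZl measurableT M w_int) FMw.
split=> // M0; apply: ess_bounded_op => //; apply: ess_bounded_cls => // x.
by rewrite (le_trans (FMw x))// ler_piMr.
Qed.

(** Multiplication by [w] turns bounded functions into bounded integrable ones, on
    which [S] acts. *)
Lemma normal_weighted_pair g : cintegrable g ->
  normal_functional (fun f => pair (op (cls mu (fun x => Complex (w x * f x) 0))) g).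
Proof.
move=> gi.
have abs_bound f : bounded_measurable f -> exists M, [/\ 0 <= M,
    measurable_fun [set: T] f & forall x, `|f x| <= M].
  move=> [mf [M fM]]; exists `|M|; split => // x.
  by rewrite (le_trans (fM x))// ler_norm.
split=> [f1 f2 /abs_bound[M1 [M10 m1 b1]] /abs_bound[M2 [M20 m2 b2]]||].
- have [mF1 _ i1 /(_ M10) e1] := cls_real_bound m1 b1.
  have [mF2 _ i2 /(_ M20) e2] := cls_real_bound m2 b2.
  rewrite -(pairD e1 e2 gi) -(opD S i1 i2) -(clsD mu mF1 mF2).
  congr (pair (op (cls mu _)) g).
  by apply/funext => x; rewrite mulrDr; congr Complex; rewrite addr0.
- move=> a f /abs_bound[M [M0 m b]].
  have [mF _ i /(_ M0) e] := cls_real_bound m b.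
  rewrite -(pairZ _ e gi) -(opZ S _ i) -(clsZ mu _ mF).
  congr (pair (op (cls mu _)) g).
  by apply/funext => x; rewrite mulrCA; apply/eqP; rewrite eq_complex/=;
    apply/andP; split; apply/eqP; ring.
- move=> M f_ f mf_ mf f_M fM f_f.
  have [t|T0] := pselect (exists t : T, True); last first.
    rewrite (_ : f_ = fun=> f); first exact: cvg_cst.
    by apply/funext => n; apply/funext => x; exfalso; apply: T0; exists x.
  have M0 : 0 <= M by case: t => t _; rewrite (le_trans _ (fM t)).
  apply: (@pair_op_cvg _ _ _ _ _ S_ds M (fun x => M * w x)) => //.
  + by move=> n; have [] := cls_real_bound (mf_ n) (f_M n).
  + by have [] := cls_real_bound mf fM.
  + exact: (integrableZl measurableT M w_int).
  + by move=> x; rewrite ler_piMr.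
  + by move=> n x; have [_ ? _ _] := cls_real_bound (mf_ n) (f_M n).
  + by move=> x; have [_ ? _ _] := cls_real_bound mf fM.
  + move=> x; rewrite (_ : (fun n => _) = fun n => w x * `|f_ n x - f x|).
      rewrite -[X in _ --> X](mulr0 (w x)); apply: (@cvgMr R).
      by apply/norm_cvg0P/(subr_cvg0 (V := R^o)); exact: f_f.
    apply/funext => n /=; rewrite oppr0 addr0 expr0n addr0 sqrtr_sqr -mulrBr.
    by rewrite normrM (gtr0_norm (w_gt0 x)).
Qed.

(** The density [rho] of the weighted functional only represents it on multiples of
    [w]; dividing by [w] is harmless on each level set. Integrability of
    [b = rho / w] comes from testing against the sign of [b]: the sup-norm bound
    of [S] gives [\int_(level n) `|b| <= \int `|g|] for all [n]. *)
Lemma real_preadjoint g : cintegrable g -> exists b : T -> R,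
  [/\ measurable_fun [set: T] b, mu.-integrable [set: T] (EFin \o b) &
  forall n f, bounded_measurable f ->
    pair (op (cls mu (fun x => Complex (f x * \1_(level n) x) 0))) g =
    \int[mu]_x (f x * \1_(level n) x * b x)].
Proof.
move=> gi; have nphi := normal_weighted_pair gi.
have phi_null A : measurable A -> mu A = 0%E ->
    pair (op (cls mu (fun x => Complex (w x * \1_A x) 0))) g = 0.
  move=> mA A0; rewrite (_ : cls _ _ = 0).
    have i0 : cintegrable (0 : L0 mu) by apply/mem_cL1P; exact: rpred0.
    have -> : op 0 = 0 by have := opZ S 0 i0; rewrite !scale0r.
    rewrite (@pair_ae _ _ _ _ _ _ (cst 0)) ?Rintegral_cst ?mul0r//.
    by apply: filterS (L0_fun0 mu) => x ->; rewrite mul0r.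
  apply: eq_clsP.
    by apply: cmeasurable_real; apply: measurable_funM => //; exact: measurable_indic.
  have A_ae : {ae mu, forall x, ~ A x}.
    by exists A; split => // x /= /contrapT.
  apply: filterS2 (L0_fun0 mu) A_ae => x -> nAx.
  by rewrite indicE memNset// mulr0.
have [rho [mrho irho rhoE]] := normal_functional_density mu_sigma_finite nphi phi_null.
pose b x := rho x / w x.
have mVw : measurable_fun [set: T] (fun x => (w x)^-1).
  rewrite (_ : (fun x => _) = fun x => w x `^ (-1)).
    exact: (measurableT_comp (@measurable_powR R (-1)) mw).
  by apply/funext => x; rewrite powR_inv1// ltW.
have mb : measurable_fun [set: T] b by exact: measurable_funM.
have blevel n : bounded_measurable (fun x => \1_(level n) x / w x).
  split; first by apply: measurable_funM => //; exact/measurable_indic/measurable_level.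
  exists n.+1%:R => x; rewrite indicE.
  have [xn|xn] := pselect (level n x); last by rewrite memNset// mul0r normr0.
  rewrite mem_set// mul1r ger0_norm; last by rewrite invr_ge0 ltW.
  by rewrite invf_ple ?posrE// ltW.
have bE n f : bounded_measurable f ->
    pair (op (cls mu (fun x => Complex (f x * \1_(level n) x) 0))) g =
    \int[mu]_x (f x * \1_(level n) x * b x).
  move=> bf; rewrite -[RHS](_ : \int[mu]_x (f x * (\1_(level n) x / w x) * rho x) = _).
    rewrite -rhoE; last exact: bounded_measurableM.
    congr (pair (op (cls mu _)) g); apply/funext => x; congr Complex.
    by rewrite mulrCA; congr (_ * _); rewrite mulrCA divff ?mulr1// gt_eqF.
  by apply: eq_Rintegral => x _; rewrite /b -!mulrA; congr (_ * (_ * _)); rewrite mulrC.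
exists b; split => //.
apply/integrableP; split; first exact/measurable_EFinP.
have mterm n : measurable_fun [set: T] (fun x => (`|b x| * \1_(level n) x)%:E).
  apply/measurable_EFinP/measurable_funM; first exact: measurableT_comp.
  exact/measurable_indic/measurable_level.
have term_le n : (\int[mu]_x (`|b x| * \1_(level n) x)%:E <=
    \int[mu]_x (absn g x)%:E)%E.
  pose sgn x : R := if 0 <= b x then 1 else -1.
  have sgnb x : sgn x * b x = `|b x|.
    by rewrite /sgn; case: ifPn => [/ger0_norm ->|]; rewrite ?mul1r// mulN1r
      -ltNge => /ltr0_norm ->.
  have bsgn : bounded_measurable sgn.
    split; last by exists 1 => x; rewrite /sgn; case: ifP; rewrite ?normrN normr1.
    by apply: measurable_fun_ifT => //; exact: measurable_fun_ler.
  have b1 : bounded_measurable (\1_(level n) : T -> R).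
    exact/bounded_measurable_indic/measurable_level.
  pose F x := Complex (sgn x * \1_(level n) x) 0.
  have i1 x : sgn x * \1_(level n) x = w x * (sgn x * (\1_(level n) x / w x)).
    by rewrite mulrCA; congr (_ * _); rewrite mulrCA divff ?mulr1// gt_eqF.
  have [msgn1 [M sgn1M]] := bounded_measurableM bsgn (blevel n).
  have Fi : cintegrable (cls mu F).
    rewrite /F; under eq_fun do rewrite i1.
    by have [] := cls_real_bound msgn1 sgn1M.
  have mF : cmeasurable F.
    by apply: cmeasurable_real; have [] := bounded_measurableM bsgn b1.
  have F1 : ess_bounded 1 (op (cls mu F)).
    apply: ess_bounded_op => //; apply: ess_bounded_cls => // x.
    rewrite /F normc_real normrM /sgn.
    rewrite [X in X * _](_ : _ = 1); last by case: ifP; rewrite ?normrN normr1.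
    by rewrite mul1r ger0_norm.
  have := normr_pair_le F1 gi; rewrite bE// => le1.
  rewrite (@le_trans _ _ (`|\int[mu]_x (sgn x * \1_(level n) x * b x)|%:E))//.
    rewrite (@eq_Rintegral _ _ _ _ _ (fun x => `|b x| * \1_(level n) x)); last first.
      by move=> x _; rewrite mulrAC sgnb.
    rewrite -[leLHS]fineK ?lee_fin ?ler_norm//.
    apply: integrable_fin_num => //.
    apply: eq_integrable (integrable_bounded_mul
      (bounded_measurableM bsgn (blevel n)) mrho irho) => // x _.
    by rewrite /= -sgnb /b; congr EFin; ring.
  apply: le_trans le1 _; apply: ae_ge0_le_integral => //.
  - by move=> x _; rewrite lee_fin mulr_ge0// absn_ge0.
  - exact/measurable_EFinP/measurable_absnM.
  - by move=> x _; rewrite lee_fin absn_ge0.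
  - exact/measurable_EFinP/measurable_absn.
  by apply: filterS F1 => x F1x _; rewrite lee_fin ler_piMl// absn_ge0.
have term_ge0 n x : setT x -> (0 <= (`|b x| * \1_(level n) x)%:E)%E.
  by move=> _; rewrite lee_fin mulr_ge0.
have term_nd x : setT x ->
    nondecreasing_seq (fun n => (`|b x| * \1_(level n) x)%:E).
  move=> _ m n mn; rewrite lee_fin ler_wpM2l// !indicE ler_nat.
  have [xm|xm] := pselect (level m x); last by rewrite (memNset xm).
  rewrite !mem_set//; apply: le_lt_trans xm.
  by rewrite lef_pV2 ?posrE// ler_nat.
have := @cvg_monotone_convergence _ _ _ mu _ measurableT _ mterm term_ge0 term_nd.
rewrite (_ : (\int[mu]_x limn _)%E = (\int[mu]_x `|(EFin \o b) x|)%E); last first.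
  apply: eq_integral => x _; apply/cvg_lim => //.
  apply: cvg_EFin; first exact: nearW.
  rewrite -[X in _ --> X]mulr1; apply: (@cvgMr R); exact: indic_level_cvg.
move=> cvgb; apply: (@le_lt_trans _ _ (\int[mu]_x (absn g x)%:E)%E).
  rewrite -(cvg_lim _ cvgb)//; apply: lime_le; first exact: cvgP cvgb.
  exact: nearW.
exact/cintegrableP.
Qed.

Lemma complex_level_split F n x : F x * Complex (\1_(level n) x) 0 =
  Complex (Re (F x) * \1_(level n) x) 0 +
  'i%C * Complex (Im (F x) * \1_(level n) x) 0.
Proof.
by case: (F x) => a b; apply/eqP; rewrite eq_complex/=; apply/andP; split;
  apply/eqP; ring.
Qed.

(** For real [f1] and [f2], linearity of [S] gives
    [pair (S (f1 + 'i f2)) g = pair (S f1) g + pair (S f2) ('i g)]. With [b] and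
    [c] the real densities for [g] and ['i g], the right-hand side is the
    integral of [Re ((f1 + 'i f2) * (b - 'i c))]. *)
Lemma bounded_preadjoint g : cintegrable g -> exists2 h, cintegrable h &
  forall M u, ess_bounded M u -> cintegrable u -> pair (op u) g = pair u h.
Proof.
move=> gi.
have [b [mb ib bE]] := real_preadjoint gi.
have [c [mc ic cE]] := real_preadjoint (cintegrableZ 'i%C gi).
pose H x := Complex (b x) (- c x).
have mH : cmeasurable H by split => //=; exact: measurableT_comp.
have Hi : cintegrable (cls mu H).
  apply: cintegrable_cls mH (integrableD measurableT (integrable_norm ib)
    (integrable_norm ic)) _ => x.
  by rewrite (le_trans (normc_le_ReIm _))//= normrN.
exists (cls mu H) => // M' u uM' ui.
(* A representative of [u] that is bounded everywhere. *)
pose M := `|M'|; have M_ge0 : 0 <= M by exact: normr_ge0.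
have uM : ess_bounded M u by apply: ess_boundedS uM'; exact: ler_norm.
pose B := [set x | absn u x <= M].
have mB : measurable B.
  rewrite -[X in measurable X]setTI; apply: measurable_fun_ler => //.
  exact: measurable_absn.
pose F x := L0_fun u x * Complex (\1_B x) 0.
have mF : cmeasurable F.
  apply: cmeasurableM; first exact: cmeasurable_L0_fun.
  by apply: cmeasurable_real; exact: measurable_indic.
have FM x : normc (F x) <= M.
  rewrite Normc.normcM normc_real ger0_norm// indicE.
  have [Bx|nBx] := pselect (B x); first by rewrite mem_set// mulr1.
  by rewrite memNset// mulr0 normr_ge0.
have F_repr : cls mu F = u.
  apply: eq_clsP => //; apply: filterS uM => x ux.
  by rewrite /F indicE mem_set// mulr1.
pose Fn n x := F x * Complex (\1_(level n) x) 0.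
have mFn n : cmeasurable (Fn n).
  by apply: cmeasurableM => //; apply: cmeasurable_real;
    exact/measurable_indic/measurable_level.
have FnF n x : normc (Fn n x) <= normc (F x).
  rewrite Normc.normcM normc_real ger0_norm//.
  by rewrite ler_piMr// normc_ge0.
have Fn_cvg x : normc (Fn n x - F x) @[n --> \oo] --> (0 : R).
  apply: cvg_near_cst; apply: filterS (level_cvg x) => n xn.
  by rewrite /Fn indicE mem_set// mulr1 subrr Normc.normc0.
have iF : mu.-integrable [set: T] (EFin \o (fun x => normc (F x))).
  apply: integrable_ae_le ui _; first exact: measurable_normc.
  apply: filterS uM => x ux; rewrite ger0_norm ?normc_ge0//.
  by rewrite /F indicE mem_set// mulr1.
have Fnu n : pair (op (cls mu (Fn n))) g = pair (cls mu (Fn n)) (cls mu H).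
  pose f1 x := Re (F x); pose f2 x := Im (F x).
  have bf1 : bounded_measurable f1.
    split; first exact: mF.1.
    by exists M => x; exact: le_trans (normr_Re_le_normc _) (FM x).
  have bf2 : bounded_measurable f2.
    split; first exact: mF.2.
    by exists M => x; exact: le_trans (normr_Im_le_normc _) (FM x).
  have b1 : bounded_measurable (\1_(level n) : T -> R).
    exact/bounded_measurable_indic/measurable_level.
  pose C1 x := Complex (f1 x * \1_(level n) x) 0.
  pose C2 x := Complex (f2 x * \1_(level n) x) 0.
  have [m1 _] := bounded_measurableM bf1 b1.
  have [m2 _] := bounded_measurableM bf2 b1.
  have mC1 : cmeasurable C1 by exact: cmeasurable_real.
  have mC2 : cmeasurable C2 by exact: cmeasurable_real.
  have C1F x : normc (C1 x) <= normc (F x).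
    apply: le_trans (normr_Re_le_normc (F x)).
    rewrite /C1 normc_real normrM ler_piMr//.
    by rewrite ger0_norm.
  have C2F x : normc (C2 x) <= normc (F x).
    apply: le_trans (normr_Im_le_normc (F x)).
    rewrite /C2 normc_real normrM ler_piMr//.
    by rewrite ger0_norm.
  have i1 := cintegrable_cls mC1 iF C1F.
  have i2 := cintegrable_cls mC2 iF C2F.
  have e1 : ess_bounded M (op (cls mu C1)).
    apply: ess_bounded_op => //; apply: ess_bounded_cls => // x.
    exact: le_trans (C1F x) (FM x).
  have e2 : ess_bounded M (op (cls mu C2)).
    apply: ess_bounded_op => //; apply: ess_bounded_cls => // x.
    exact: le_trans (C2F x) (FM x).
  have mi : cmeasurable (fun x => 'i%C * C2 x).
    by apply: cmeasurableM => //; exact: cmeasurable_cst.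
  rewrite [X in pair (op (cls mu X))](_ : _ = fun x => C1 x + 'i%C * C2 x);
    last by apply/funext => x; exact: complex_level_split.
  rewrite (clsD mu mC1 mi) (clsZ mu _ mC2) (opD S i1 (cintegrableZ _ i2)).
  rewrite (opZ S _ i2) (pairD e1 (ess_boundedZ _ e2) gi) pairZC.
  rewrite [X in X + _](bE _ _ bf1) [X in _ + X](cE _ _ bf2) -RintegralD//; last 2 first.
  - exact: integrable_bounded_mul (bounded_measurableM bf1 b1) mb ib.
  - exact: integrable_bounded_mul (bounded_measurableM bf2 b1) mc ic.
  apply/esym/pair_ae.
    by apply: measurable_funD; exact: measurable_funM.
  apply: filterS2 (L0_fun_cls mu (mFn n)) (L0_fun_cls mu mH) => x -> ->.
  rewrite /Fn complex_level_split /H /f1 /f2; move: (F x) => [p q] /=; ring.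
have c1 : (fun n => pair (op (cls mu (Fn n))) g) @ \oo --> pair (op (cls mu F)) g.
  by apply: (@pair_op_cvg _ _ _ _ _ S_ds M (fun x => normc (F x))).
have c2 : (fun n => pair (cls mu (Fn n)) (cls mu H)) @ \oo -->
    pair (cls mu F) (cls mu H).
  apply: (@pair_cvg _ _ _ _ M) => //.
  - by move=> n; apply: ess_bounded_cls => // x; exact: le_trans (FnF n x) (FM x).
  - exact: ess_bounded_cls.
  have clsFn : {ae mu, forall x n, L0_fun (cls mu (Fn n)) x = Fn n x}.
    by apply/ae_foralln => n; exact: L0_fun_cls.
  apply: filterS2 clsFn (L0_fun_cls mu mF) => x Fnx ->.
  by under eq_fun do rewrite Fnx; exact: Fn_cvg.
rewrite -F_repr; apply: (cvg_unique _ c1); first exact: (@norm_hausdorff R R^o).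
by apply: cvg_trans c2; apply: near_eq_cvg; apply: nearW => n; rewrite /= Fnu.
Qed.
End bounded_preadjoint.

(** * Signed sums, separation and truncation *)

Section bounded_signed_sums.
Context (R : realType).

Lemma Re_sum (n : nat) (z : 'I_n -> R[i]) :
  Re (\sum_(k < n) z k) = \sum_(k < n) Re (z k).
Proof.
by apply: (big_morph (@complex.Re R)) => //= -[a b] [a' b'].
Qed.

Lemma Re_realM (a : R) (z : R[i]) : Re (Complex a 0 * z) = a * Re z.
Proof. by case: z => b c /=; rewrite mul0r subr0. Qed.

(** Choosing the sign of each real part turns a bound for all signed sums into
    a bound for the sum of the absolute values. *)
Lemma signed_sums_normRe (z : nat -> R[i]) (M : R) :
  (forall s : seq bool,
     normc (\sum_(k < size s) Complex ((-1) ^+ nth false s k) 0 * z k) <= M) ->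
  forall n, \sum_(k < n) `|Re (z k)| <= M.
Proof.
move=> zM n; pose s := mkseq (fun k => Re (z k) < 0) n.
apply: le_trans (zM s); apply: le_trans (normr_Re_le_normc _).
apply: le_trans (ler_norm _); rewrite Re_sum size_mkseq.
apply: ler_sum => k _; rewrite Re_realM nth_mkseq//.
by case: ltP => [/ltr0_norm ->|/ger0_norm ->]; rewrite ?expr1 ?expr0 ?mulN1r ?mul1r.
Qed.

Lemma signed_sums_cvg_Re (z : nat -> R[i]) (M : R) :
  (forall s : seq bool,
     normc (\sum_(k < size s) Complex ((-1) ^+ nth false s k) 0 * z k) <= M) ->
  cvgn (fun n => Re (\sum_(k < n) z k)).
Proof.
move=> zM; have zM' := signed_sums_normRe zM.
rewrite (_ : (fun n => _) = series (fun k => Re (z k))); last first.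
  by apply/funext => n; rewrite Re_sum /series/= big_mkord.
apply: (@normed_cvg R R^o).
rewrite (_ : [normed series _] = fun n => \sum_(k < n) `|Re (z k)|); last first.
  by apply/funext => n; rewrite /normed_series_of /= /series /= big_mkord.
apply: nondecreasing_is_cvgn.
  by apply/nondecreasing_seqP => n; rewrite big_ord_recr lerDl.
by exists M => _ [n _ <-] /=; exact: zM'.
Qed.

(** Rotate by [- 'i]. *)
Lemma signed_sums_cvg_Im (z : nat -> R[i]) (M : R) :
  (forall s : seq bool,
     normc (\sum_(k < size s) Complex ((-1) ^+ nth false s k) 0 * z k) <= M) ->
  cvgn (fun n => Im (\sum_(k < n) z k)).
Proof.
move=> zM.
rewrite (_ : (fun n => _) = fun n => Re (\sum_(k < n) (Complex 0 (-1) * z k))).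
  apply: (@signed_sums_cvg_Re (fun k => Complex 0 (-1) * z k) M) => s.
  under eq_bigr do rewrite mulrCA.
  rewrite -mulr_sumr Normc.normcM [X in X * _]/= expr0n add0r sqrrN expr1n.
  by rewrite sqrtr1 mul1r; exact: zM.
apply/funext => n; rewrite -mulr_sumr; case: (\sum_(_ < _) _) => a b /=; ring.
Qed.

End bounded_signed_sums.

Section truncation.
Context d (T : measurableType d) (R : realType).
Variable mu : {measure set T -> \bar R}.
Variable w : T -> R.
Hypotheses (mw : measurable_fun [set: T] w) (w_gt0 : forall x, 0 < w x)
  (w_le1 : forall x, w x <= 1) (w_int : mu.-integrable [set: T] (EFin \o w)).
Implicit Types (u v g h : L0 mu) (F G : T -> R[i]) (M : R) (f : T -> R).

(** Against [w * conj u], which is integrable, the pairing is the integral of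
    [w * absn u ^+ 2]. *)
Lemma pair_separated M u : ess_bounded M u ->
  (forall g, cintegrable g -> pair u g = 0) -> u = 0.
Proof.
move=> uM u0.
pose F x := Complex (w x) 0 * Complex (Re (L0_fun u x)) (- Im (L0_fun u x)).
have [mr mi] := cmeasurable_L0_fun u.
have mF : cmeasurable F.
  apply: cmeasurableM; first exact: cmeasurable_real.
  by split => //=; exact: measurableT_comp.
have Fi : cintegrable (cls mu F).
  apply: (cintegrable_cls_ae mF (integrableZl measurableT M w_int)).
  apply: filterS uM => x ux.
  rewrite Normc.normcM normc_real gtr0_norm// mulrC.
  rewrite ler_wpM2r//; first exact: ltW.
  by move: ux; rewrite /absn; case: (L0_fun u x) => a b /=; rewrite sqrrN.
pose e x := w x * (Re (L0_fun u x) ^+ 2 + Im (L0_fun u x) ^+ 2).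
have me : measurable_fun [set: T] e.
  by apply: measurable_funM => //; apply: measurable_funD; exact: measurable_funX.
have e_ge0 x : 0 <= e x by rewrite mulr_ge0 ?addr_ge0 ?sqr_ge0 ?ltW.
have eE : {ae mu, forall x, Re (L0_fun u x * L0_fun (cls mu F) x) = e x}.
  apply: filterS (L0_fun_cls mu mF) => x ->; rewrite /F /e.
  by case: (L0_fun u x) => a b /=; ring.
have ie : mu.-integrable [set: T] (EFin \o e).
  apply: integrable_ae_le (integrable_norm (integrable_pair uM Fi)) _ => //.
  by apply: filterS eE => x xe /=; rewrite -xe.
have := u0 _ Fi; rewrite (pair_ae me eE) => e0.
have : (\int[mu]_x `|(EFin \o e) x| = 0)%E.
  rewrite (eq_integral (EFin \o e)); last by move=> x _ /=; rewrite ger0_norm.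
  by rewrite -[LHS]fineK ?[X in X%:E]e0//; exact: integrable_fin_num.
move/(ae_eq_integral_abs mu measurableT (proj2 (measurable_EFinP _ _) me)).
move=> ae0; apply: L0_ext; apply: filterS2 ae0 (L0_fun0 mu) => x + ->.
move=> /(_ Logic.I)/= [] /eqP; rewrite mulf_eq0 gt_eqF//= paddr_eq0 ?sqr_ge0//.
rewrite !sqrf_eq0 => /andP[/eqP r0 /eqP i0].
by case: (L0_fun u x) r0 i0 => a b /= -> ->.
Qed.

Lemma eq_pair M M' u v : ess_bounded M u -> ess_bounded M' v ->
  (forall g, cintegrable g -> pair u g = pair v g) -> u = v.
Proof.
move=> uM vM uv; apply/eqP; rewrite -subr_eq0; apply/eqP.
apply: (pair_separated (ess_boundedB uM vM)) => g gi.
by rewrite (pairB uM vM gi) uv// subrr.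
Qed.

Local Notation level := (level w).

Definition trunc n u : L0 mu :=
  cls mu (fun x => Complex (\1_(level n) x) 0 * L0_fun u x).

Lemma L0_fun_trunc n u : {ae mu, forall x,
  L0_fun (trunc n u) x = Complex (\1_(level n) x) 0 * L0_fun u x}.
Proof.
apply: L0_fun_cls; apply: cmeasurableM; last exact: cmeasurable_L0_fun.
by apply/cmeasurable_real/measurable_indic/measurable_level.
Qed.

Lemma ess_bounded_trunc M n u : ess_bounded M u -> ess_bounded M (trunc n u).
Proof.
move=> uM; apply: filterS2 uM (L0_fun_trunc n u) => x ux.
rewrite /absn => ->; apply: le_trans ux; rewrite Normc.normcM normc_real.
by rewrite ger0_norm// ler_piMl ?absn_ge0.
Qed.

Lemma cintegrable_trunc M n u : ess_bounded M u -> cintegrable (trunc n u).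
Proof.
move=> uM; apply: (@cintegrable_cls_ae _ _ _ mu _ (fun x => (`|M| * n.+1%:R) * w x)).
- apply: cmeasurableM; last exact: cmeasurable_L0_fun.
  by apply/cmeasurable_real/measurable_indic/measurable_level.
- exact: (integrableZl measurableT _ w_int).
apply: filterS uM => x ux; rewrite Normc.normcM normc_real ger0_norm// indicE.
have [xn|xn] := pselect (level n x); last first.
  by rewrite memNset// mul0r !mulr_ge0// ltW.
rewrite mem_set// mul1r (le_trans ux)// (le_trans (ler_norm _))//.
rewrite -mulrA ler_peMr// mulrC -ler_pdivrMr// mul1r; exact: ltW.
Qed.

Lemma trunc_cvg M u g : ess_bounded M u -> cintegrable g ->
  (fun n => pair (trunc n u) g) @ \oo --> pair u g.
Proof.
move=> uM gi; apply: (@pair_cvg _ _ _ _ M) => //.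
  by move=> n; exact: ess_bounded_trunc.
have ae_tr : {ae mu, forall x n,
    L0_fun (trunc n u) x = Complex (\1_(level n) x) 0 * L0_fun u x}.
  by apply/ae_foralln => n; exact: L0_fun_trunc.
apply: filterS ae_tr => x trx; apply: cvg_near_cst.
apply: filterS (level_cvg w_gt0 x) => n xn.
by rewrite trx indicE mem_set// mul1r subrr Normc.normc0.
Qed.

End truncation.

(** * Almost everywhere convergence of the truncated images *)

Section almost_everywhere.
Context d (T : measurableType d) (R : realType).
Variable mu : {measure set T -> \bar R}.

Lemma ae_forall_count (I : countType) (P : I -> T -> Prop) :
  (forall i, {ae mu, forall x, P i x}) -> {ae mu, forall x i, P i x}.
Proof.
move=> aeP.
have : {ae mu, forall x n, if unpickle n is Some i then P i x else True}.
  by apply/ae_foralln => n; case: unpickle => [i|]; [exact: aeP|exact: aeW].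
by apply: filterS => x Px i; have := Px (pickle i); rewrite pickleK.
Qed.

(** The upper limit is a measurable choice of the limit that is defined
    everywhere. *)
Lemma ae_cvg_measurable (f : nat -> T -> R) :
  (forall n, measurable_fun [set: T] (f n)) ->
  {ae mu, forall x, cvgn (f ^~ x)} -> exists2 g : T -> R,
    measurable_fun [set: T] g & {ae mu, forall x, f ^~ x @ \oo --> g x}.
Proof.
move=> mf fcvg; exists (fun x => fine (limn_esup (fun n => (f n x)%:E))).
  apply: measurableT_comp => //.
  by apply: (measurable_fun_limn_esup (f := fun n x => (f n x)%:E)) => n;
    exact/measurable_EFinP.
apply: filterS fcvg => x /cvg_ex[l fl].
have /cvg_limn_einf_sup[_ ->] : (fun n => (f n x)%:E) @ \oo --> l%:E.
  by apply: cvg_EFin => //; exact: nearW.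
exact: fl.
Qed.

Lemma L0_fun_sum (I : Type) (r : seq I) (a : I -> R[i]) (u : I -> L0 mu) :
  {ae mu, forall x, L0_fun (\sum_(i <- r) a i *: u i) x =
                    \sum_(i <- r) a i * L0_fun (u i) x}.
Proof.
elim: r => [|i r IH].
  by rewrite big_nil; apply: filterS (L0_fun0 mu) => x ->; rewrite big_nil.
rewrite big_cons; apply: filterS2 IH (L0_fun_linear (a i) (u i)
  (\sum_(i <- r) a i *: u i)) => x IH ->.
by rewrite IH big_cons.
Qed.

End almost_everywhere.

Section extension_to_Linfty.
Context d (T : measurableType d) (R : realType).
Variable mu : {measure set T -> \bar R}.
Variables (S : {linear L1 mu -> L1 mu}) (S_ds : dunford_schwartz S).
Variable w : T -> R.
Hypotheses (mw : measurable_fun [set: T] w) (w_gt0 : forall x, 0 < w x)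
  (w_le1 : forall x, w x <= 1) (w_int : mu.-integrable [set: T] (EFin \o w)).
Implicit Types (u v g h : L0 mu) (M : R).

Local Notation op := (class_op S).
Local Notation level := (level w).
Local Notation trunc := (trunc w).

Definition slice k u : L0 mu := trunc k.+1 u - trunc k u.

Lemma trunc0 u : trunc 0%N u = 0.
Proof.
apply: L0_ext; apply: filterS2 (L0_fun_trunc mw 0 u) (L0_fun0 mu) => x -> ->.
rewrite indicE memNset ?mul0r//; apply/negP.
by rewrite -leNgt invr1.
Qed.

Lemma sum_slice n u : \sum_(k < n) slice k u = trunc n u.
Proof.
by rewrite -(big_mkord xpredT (fun k => slice k u)) telescope_sumr// trunc0 subr0.
Qed.

Lemma cintegrable_slice M k u : ess_bounded M u -> cintegrable (slice k u).
Proof.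
by move=> uM; apply: cintegrableB;
  exact: (cintegrable_trunc mw w_gt0 w_int _ uM).
Qed.

(** The slices are disjointly supported, so that changing signs does not affect
    the sup norm of their sums. *)
Lemma ess_bounded_signed_slices M u (s : seq bool) : ess_bounded M u ->
  ess_bounded M
    (\sum_(k < size s) Complex ((-1) ^+ nth false s k) 0 *: slice k u).
Proof.
move=> uM; pose D k x : R := \1_(level k.+1) x - \1_(level k) x.
have D_ge0 k x : 0 <= D k x.
  rewrite subr_ge0 !indicE ler_nat.
  have [xk|xk] := pselect (level k x); last by rewrite (memNset xk).
  rewrite !mem_set//; apply: le_lt_trans xk.
  by rewrite lef_pV2 ?posrE// ler_nat.
have sliceE : {ae mu, forall x k,
    L0_fun (slice k u) x = Complex (D k x) 0 * L0_fun u x}.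
  apply/ae_foralln => k.
  apply: filterS3 (L0_funB (trunc k.+1 u) (trunc k u))
    (L0_fun_trunc mw k.+1 u) (L0_fun_trunc mw k u) => x -> -> ->.
  by rewrite -mulrBl; congr (_ * _); rewrite /D; apply/eqP;
    rewrite eq_complex/= subr0 !eqxx.
pose a (k : 'I_(size s)) : R := (-1) ^+ nth false s k.
apply: filterS3 uM sliceE (L0_fun_sum (index_enum _)
  (fun k : 'I_(size s) => Complex (a k) 0) (fun k => slice k u)) => x ux slx.
rewrite /absn => ->.
rewrite (eq_bigr (fun k => Complex (a k * D k x) 0 * L0_fun u x)); last first.
  move=> k _; rewrite slx mulrA; congr (_ * _); apply/eqP.
  by rewrite eq_complex/= !mulr0 !mul0r subr0 addr0 !eqxx.
rewrite -mulr_suml Normc.normcM; apply: le_trans ux.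
rewrite ler_piMl ?absn_ge0//.
have -> : \sum_i Complex (a i * D i x) 0 = Complex (\sum_i a i * D i x) 0.
  by rewrite (big_morph (fun r : R => Complex r 0) (id1 := 0) (op1 := +%R))// =>
    p q; apply/eqP; rewrite eq_complex/= addr0 !eqxx.
rewrite normc_real (le_trans (ler_norm_sum _ _ _))//.
rewrite (eq_bigr (fun k : 'I__ => D k x)); last first.
  by move=> k _; rewrite normrM normrX normrN1 expr1n mul1r ger0_norm.
by rewrite -(big_mkord xpredT (fun k => D k x)) telescope_sumr.
Qed.

Lemma signed_op_slices M u : 0 <= M -> ess_bounded M u ->
  {ae mu, forall x (s : seq bool), normc (\sum_(k < size s)
    Complex ((-1) ^+ nth false s k) 0 * L0_fun (op (slice k u)) x) <= M}.
Proof.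
move=> M0 uM; apply: ae_forall_count => s.
pose a (k : 'I_(size s)) : R[i] := Complex ((-1) ^+ nth false s k) 0.
have [i opE] := @op_sum _ _ _ _ S _ (index_enum 'I_(size s)) (fun k => a k *: slice k u)
  (fun k => cintegrableZ _ (cintegrable_slice k uM)).
have := ess_bounded_op S_ds M0 i (ess_bounded_signed_slices s uM).
rewrite opE (eq_bigr (fun k => a k *: op (slice k u))); last first.
  by move=> k _; rewrite opZ//; exact: cintegrable_slice uM.
apply: filterS2 (L0_fun_sum (index_enum _) a (fun k => op (slice k u))) => x.
by rewrite /absn => ->.
Qed.

(** The image of a truncation is the partial sum of the images of the slices.
    For almost every point all signed sums of these values are bounded by [M],
    so the series converges absolutely there. *)
Lemma extension_exists M u : 0 <= M -> ess_bounded M u ->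
  exists2 q, ess_bounded M q & forall g, cintegrable g ->
    (fun n => pair (op (trunc n u)) g) @ \oo --> pair q g.
Proof.
move=> M0 uM; pose un n := op (trunc n u).
have un_sum : {ae mu, forall x n,
    L0_fun (un n) x = \sum_(k < n) L0_fun (op (slice k u)) x}.
  apply/ae_foralln => n.
  have [_ opE] := @op_sum _ _ _ _ S _ (index_enum 'I_n) (fun k => slice k u)
    (fun k => cintegrable_slice k uM).
  rewrite /un -sum_slice opE.
  have := L0_fun_sum (index_enum 'I_n) (fun=> 1) (fun k => op (slice k u)).
  under eq_bigr do rewrite scale1r.
  by apply: filterS => x ->; apply: eq_bigr => k _; rewrite mul1r.
have unM n : ess_bounded M (un n).
  apply: ess_bounded_op => //; first exact: (cintegrable_trunc mw w_gt0 w_int n uM).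
  exact: ess_bounded_trunc.
have cvgRe : {ae mu, forall x, cvgn (fun n => Re (L0_fun (un n) x))}.
  apply: filterS2 un_sum (signed_op_slices M0 uM) => x unx sgx.
  by under eq_fun do rewrite unx;
    exact: (@signed_sums_cvg_Re _ (fun k => L0_fun (op (slice k u)) x) M sgx).
have cvgIm : {ae mu, forall x, cvgn (fun n => Im (L0_fun (un n) x))}.
  apply: filterS2 un_sum (signed_op_slices M0 uM) => x unx sgx.
  by under eq_fun do rewrite unx;
    exact: (@signed_sums_cvg_Im _ (fun k => L0_fun (op (slice k u)) x) M sgx).
have [qr mqr qrE] := ae_cvg_measurable
  (fun n => (cmeasurable_L0_fun (un n)).1) cvgRe.
have [qi mqi qiE] := ae_cvg_measurable
  (fun n => (cmeasurable_L0_fun (un n)).2) cvgIm.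
pose Q x := Complex (qr x) (qi x).
have mQ : cmeasurable Q by [].
have cvgQ : {ae mu, forall x,
    normc (L0_fun (un n) x - L0_fun (cls mu Q) x) @[n --> \oo] --> (0 : R)}.
  apply: filterS3 qrE qiE (L0_fun_cls mu mQ) => x rx ix ->.
  apply: (@squeeze_cvgr _ _ _ _ (cst 0) (fun n =>
    `|Re (L0_fun (un n) x) - qr x| + `|Im (L0_fun (un n) x) - qi x|)).
  - apply: nearW => n; rewrite normc_ge0/= (le_trans (normc_le_ReIm _))//.
    by case: (L0_fun (un n) x).
  - exact: cvg_cst.
  - rewrite -[X in _ --> X](addr0 (0 : R)); apply: (@cvgD _ R^o).
    + by apply/norm_cvg0P/(subr_cvg0 (V := R^o)).
    + by apply/norm_cvg0P/(subr_cvg0 (V := R^o)).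
(* The bound passes to the limit: compare [q] with one [un n] close to it. *)
have qM : ess_bounded M (cls mu Q).
  apply: filterS2 cvgQ (ess_bounded_nat unM) => x qx unMx.
  apply/ler_addgt0Pr => e e0.
  have /cvgr0Pnorm_lt/(_ _ e0)[n _ /(_ n (leqnn n))] := qx.
  rewrite ger0_norm ?normc_ge0// => qn.
  have -> : absn (cls mu Q) x =
      normc (L0_fun (un n) x - (L0_fun (un n) x - L0_fun (cls mu Q) x)).
    by rewrite opprB addrC subrK.
  by rewrite (le_trans (le_normcD _ _))// normcN lerD ?(unMx n)// ltW.
exists (cls mu Q) => // g gi.
exact: (pair_cvg unM qM gi cvgQ).
Qed.

End extension_to_Linfty.

(** * Weak-star topology and the map on bounded classes *)

Section complex_topology.
Context (R : realType) (I : Type) (F : set_system I) (FF : Filter F).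

Lemma normr_normc (z : R[i]) : `|z| = Complex (normc z) 0.
Proof. by []. Qed.

Lemma cvg_complex (z : I -> (R[i])^o) (l : (R[i])^o) :
  (fun i => Re (z i)) @ F --> Re l -> (fun i => Im (z i)) @ F --> Im l ->
  z @ F --> l.
Proof.
move=> /(cvgrPdist_lt (V := R^o)) zr /(cvgrPdist_lt (V := R^o)) zi.
apply/cvgrPdist_lt => -[e e'].
rewrite ltcE /= => /andP[/eqP -> e0].
have e2 : 0 < e / 2 by rewrite divr_gt0.
apply: filterS2 (zr _ e2) (zi _ e2) => i zri zii.
rewrite normr_normc ltcR (splitr e).
apply: le_lt_trans (normc_le_ReIm _) _; apply: ltrD.
  by move: zri; case: (l) (z i) => ? ? [].
by move: zii; case: (l) (z i) => ? ? [].
Qed.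

Lemma cvg_Re (z : I -> (R[i])^o) (l : (R[i])^o) :
  z @ F --> l -> (fun i => Re (z i)) @ F --> Re l.
Proof.
move=> /cvgrPdist_lt zl; apply/(cvgrPdist_lt (V := R^o)) => e e0.
have e0C : 0 < Complex e 0 by rewrite ltcR.
apply: filterS (zl _ e0C) => i; rewrite normr_normc ltcR.
apply: le_lt_trans; apply: le_trans (normr_Re_le_normc _).
by case: (l) (z i) => ? ? [].
Qed.

End complex_topology.

Section weak_star_topology.
Context d (T : measurableType d) (R : realType).
Variable mu : {measure set T -> \bar R}.
Implicit Types (f q : Linfty mu) (g h : L1 mu).

(** Convergence for the supremum of initial topologies, unfolded. *)
Lemma cvg_weak_star (F : set_system (Linfty mu)) f : Filter F ->
  (F --> (f : weak_star mu)) <->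
  forall g, (fun q => duality q g) @ F --> duality f g.
Proof.
move=> FF; split=> [Ff g|Ff].
  have /(cvg_sup _ _ FF)/(_ g) Ffg := Ff.
  exact: cvg_comp Ffg (@initial_continuous _ _ (fun q => duality q g) f).
apply/cvg_sup => g A /=.
rewrite (@nbhsE (initial_topology (fun q => duality q g))) => -[_ [[B Bop <-] Bf] BA].
rewrite nbhs_filterE; apply: filterS BA _.
by apply: (Ff g); exact: open_nbhs_nbhs.
Qed.

Lemma cintegrable_L1 g : cintegrable (val g).
Proof. by apply/mem_cL1P; exact: cLp_subproof. Qed.

Lemma ess_bounded_Linfty f :
  0 <= fine (cLnorm +oo f) /\ ess_bounded (fine (cLnorm +oo f)) (val f).
Proof.
have f0 : (0 <= cLnorm +oo f)%E by exact: Lnorm_ge0.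
have foo : (cLnorm +oo f < +oo)%E by exact: (set_mem (cLp_subproof f)).
split; first exact: fine_ge0.
by apply/cLnormy_leP; [exact: fine_ge0|rewrite fineK// ge0_fin_numE].
Qed.

Lemma dualityE f g : duality f g =
  Complex (pair (val f) (val g)) (pair (val f) ((- 'i%C) *: val g)).
Proof.
congr Complex; apply/esym/pair_ae.
  by have [] := cmeasurableM (cmeasurable_L0_fun (val f)) (cmeasurable_L0_fun (val g)).
apply: filterS (L0_funZ (- 'i%C) (val g)) => x ->.
by case: (L0_fun (val f) x) (L0_fun (val g) x) => a b [c e] /=; ring.
Qed.

End weak_star_topology.

Section extension_operator.
Context d (T : measurableType d) (R : realType).
Variable mu : {measure set T -> \bar R}.
Hypothesis mu_sigma_finite : sigma_finite [set: T] mu.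
Variables (S : {linear L1 mu -> L1 mu}) (S_ds : dunford_schwartz S).
Implicit Types (u v : L0 mu) (f q : Linfty mu) (g h : L1 mu).

Local Notation op := (class_op S).

(** Only bounded [u] are tested, since [pair] need not converge on two
    integrable classes. *)
Definition preadjoint g h := forall M u,
  ess_bounded M u -> cintegrable u -> pair (op u) (val g) = pair u (val h).

Lemma preadjoint_exists g : exists h, preadjoint g h.
Proof.
have [w [mw w0 w1 wi]] := sigma_finite_weight mu_sigma_finite.
have [h /mem_cL1P hi hE] :=
  bounded_preadjoint mu_sigma_finite S_ds mw w0 w1 wi (cintegrable_L1 g).
by exists (CLp hi).
Qed.

Lemma preadjointZ (a : R[i]) g h : preadjoint g h -> preadjoint (a *: g) (a *: h).
Proof.
move=> gh M u uM ui; rewrite !linearZ/= -!pairZC -opZ//.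
exact: gh (ess_boundedZ a uM) (cintegrableZ a ui).
Qed.

(** Hides the weight: what remains of it is that bounded classes are weak-star
    limits of bounded integrable ones, whose images converge within the bound. *)
Lemma truncations : exists tr : nat -> Linfty mu -> Linfty mu,
  [/\ forall n f, cintegrable (val (tr n f)),
      forall f g, (fun n => pair (val (tr n f)) (val g)) @ \oo -->
        pair (val f) (val g) &
      forall f, exists q, (cLnorm +oo q <= cLnorm +oo f)%E /\
       forall g, (fun n => pair (op (val (tr n f))) (val g)) @ \oo -->
        pair (val q) (val g)].
Proof.
have [w [mw w0 w1 wi]] := sigma_finite_weight mu_sigma_finite.
have trM n f : trunc w n (val f) \in cLp (leey 1%E).
  apply/mem_cLinftyP; exists (fine (cLnorm +oo f)).
    exact: (ess_bounded_Linfty f).1.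
  exact: (ess_bounded_trunc mw n (ess_bounded_Linfty f).2).
exists (fun n f => CLp (trM n f)); split.
- by move=> n f; exact: (cintegrable_trunc mw w0 wi n (ess_bounded_Linfty f).2).
- move=> f g.
  exact: (trunc_cvg mw w0 (ess_bounded_Linfty f).2 (cintegrable_L1 g)).
- move=> f; have [M0 fM] := ess_bounded_Linfty f.
  have [q qM qE] := extension_exists S_ds mw w0 w1 wi M0 fM.
  have qoo : q \in cLp (leey 1%E) by apply/mem_cLinftyP; exists (fine (cLnorm +oo f)).
  exists (CLp qoo); split; last by move=> g; exact: qE (cintegrable_L1 g).
  rewrite -[leRHS]fineK; first exact/cLnormy_leP.
  by rewrite ge0_fin_numE ?Lnorm_ge0//; exact: (set_mem (cLp_subproof f)).
Qed.

(** Passing to the limit in [pair (S (tr n f)) g = pair (tr n f) h]. *)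
Lemma Linfty_extension : exists Q : Linfty mu -> Linfty mu,
  (forall f, (cLnorm +oo (Q f) <= cLnorm +oo f)%E) /\
  (forall f g h, preadjoint g h -> pair (val (Q f)) (val g) = pair (val f) (val h)).
Proof.
have [tr [tr_i tr_cvg trq]] := truncations.
have [Q QE] := choice trq; exists Q; split=> [f|f g h gh]; first exact: (QE f).1.
apply: (cvg_unique _ ((QE f).2 g)); first exact: (@norm_hausdorff R R^o).
apply: cvg_trans (tr_cvg f h); apply: near_eq_cvg; apply: nearW => n /=.
by rewrite (gh _ _ (ess_bounded_Linfty (tr n f)).2 (tr_i n f)).
Qed.

Lemma Linfty_ext f q :
  (forall g, pair (val f) (val g) = pair (val q) (val g)) -> f = q.
Proof.
move=> fq; apply: val_inj.
have [w [mw w0 w1 wi]] := sigma_finite_weight mu_sigma_finite.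
apply: (eq_pair mw w0 wi (ess_bounded_Linfty f).2 (ess_bounded_Linfty q).2).
by move=> g /mem_cL1P gi; exact: (fq (CLp gi)).
Qed.

End extension_operator.

(** * Gluing and uniqueness *)

(** The remaining fields of a linear map are proofs, hence irrelevant. *)
Lemma linear_fun_ext (K : pzRingType) (U V : lmodType K) (f g : {linear U -> V}) :
  f =1 g -> f = g.
Proof.
move=> /funext; case: f g => [f cf] [g cg] /= fg.
move: cf cg; rewrite fg => cf cg; congr GRing.Linear.Pack.
case: cf cg => [[a] [b]] [[a'] [b']].
by rewrite (Prop_irrelevance a a') (Prop_irrelevance b b').
Qed.

Section extension_theorem.
Context d (T : measurableType d) (R : realType).
Variable mu : {measure set T -> \bar R}.
Hypothesis mu_sigma_finite : sigma_finite [set: T] mu.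
Variables (S : {linear L1 mu -> L1 mu}) (S_ds : dunford_schwartz S).
Implicit Types (f q : Linfty mu) (g h : L1 mu) (k : L1Linfty mu).

Local Notation op := (class_op S).

Section extension_properties.
Variable Q : Linfty mu -> Linfty mu.
Hypothesis QE : forall f g h, preadjoint S g h ->
  pair (val (Q f)) (val g) = pair (val f) (val h).

Lemma extension_linear : linear Q.
Proof.
move=> a f1 f2; apply: (Linfty_ext mu_sigma_finite) => g.
have [h gh] := preadjoint_exists mu_sigma_finite S_ds g.
have b f := (ess_bounded_Linfty f).2.
rewrite (QE _ gh) !linearP/=.
rewrite (pairD (ess_boundedZ a (b f1)) (b f2) (cintegrable_L1 h)).
rewrite (pairD (ess_boundedZ a (b (Q f1))) (b (Q f2)) (cintegrable_L1 g)).
rewrite (QE _ gh) !pairZC; congr (_ + _).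
have := QE f1 (preadjointZ a gh); rewrite !linearZ/=.
by move=> ->.
Qed.

(** Both sides pair with [g'] to the same value [pair f h]. *)
Lemma extension_agrees_on_L1 f g : val f = val g -> val (Q f) = val (S g).
Proof.
move=> fg; have Sg : val (S g) \in cLp (leey 1%E).
  apply/mem_cLinftyP; have [M0 fM] := ess_bounded_Linfty f.
  exists (fine (cLnorm +oo f)) => //.
  by rewrite -opE -fg; apply: ess_bounded_op => //; rewrite fg; exact: cintegrable_L1.
rewrite -[RHS]/(val (CLp Sg)); congr val.
apply: (Linfty_ext mu_sigma_finite) => g'.
have [h g'h] := preadjoint_exists mu_sigma_finite S_ds g'.
rewrite (QE _ g'h) /= -opE -fg.
rewrite (g'h _ _ (ess_bounded_Linfty f).2)// fg; exact: cintegrable_L1.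
Qed.

(** Precomposing [duality^~ g] with [Q] gives [duality^~ h], which is one of the
    maps defining the topology. *)
Lemma extension_weak_star_continuous : continuous (Q : weak_star mu -> weak_star mu).
Proof.
move=> f; have Ff : Filter (nbhs (f : weak_star mu)) by exact: nbhs_filter.
have FQ : Filter (Q @ (f : weak_star mu)) by exact: fmap_filter.
apply/(cvg_weak_star _ FQ) => g.
have [h gh] := preadjoint_exists mu_sigma_finite S_ds g.
have QgE q : duality (Q q) g = duality q h.
  rewrite !dualityE (QE _ gh); congr Complex.
  by have := QE q (preadjointZ (- 'i%C) gh); rewrite !linearZ.
rewrite QgE.
suff : (fun q => duality (Q q) g) @ nbhs (f : weak_star mu) --> duality f h by [].
under eq_fun do rewrite QgE.
exact: ((cvg_weak_star f Ff).1 cvg_id h).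
Qed.

Lemma L1Linfty_decomposition k : exists fg : L1 mu * Linfty mu,
  val k = val fg.1 + val fg.2.
Proof.
by have /set_mem[f [g kE]] := L1Linfty_subproof k; exists (f, g).
Qed.

(** Sending [g + f] to [S g + Q f] does not depend on the decomposition, since two
    decompositions differ by an element of the intersection, where [S] and [Q]
    agree. *)
Lemma L1Linfty_map_exists : exists Tt : {linear L1Linfty mu -> L1Linfty mu},
  (forall g, Tt (L1_incl g) = L1_incl (S g)) /\
  (forall f, Tt (Linfty_incl f) = Linfty_incl (Q f)).
Proof.
have [dec decE] := choice L1Linfty_decomposition.
pose Tt k : L1Linfty mu := L1_incl (S (dec k).1) + Linfty_incl (Q (dec k).2).
have QD f1 f2 : Q (f1 - f2) = Q f1 - Q f2.
  have := extension_linear (-1) f2 f1; rewrite !scaleN1r => E.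
  by rewrite [f1 - f2]addrC E addrC.
have Q0 : Q 0 = 0 by have := QD 0 0; rewrite !subrr.
have TtE k g f : val k = val g + val f -> val (Tt k) = val (S g) + val (Q f).
  move=> kE; have E : val (f - (dec k).2) = val ((dec k).1 - g).
    by rewrite !linearB/=; apply/eqP; rewrite subr_eq addrAC -decE kE addrAC subrr add0r.
  have := extension_agrees_on_L1 E; rewrite QD !linearB/= => E'.
  rewrite -[LHS]/(val (S (dec k).1) + val (Q (dec k).2)).
  by rewrite -[val (S (dec k).1)](subrK (val (S g))) -E' addrAC subrK addrC.
have Tt_linear : linear Tt.
  move=> a k1 k2; apply: val_inj.
  rewrite (@TtE _ (a *: (dec k1).1 + (dec k2).1) (a *: (dec k1).2 + (dec k2).2)).
    by rewrite extension_linear !linearP/= scalerDr addrACA.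
  by rewrite !linearP/= !decE scalerDr addrACA.
pose TtL : {linear L1Linfty mu -> L1Linfty mu} :=
  HB.pack Tt (GRing.isLinear.Build _ _ _ _ _ Tt_linear).
exists TtL; split=> [g|f]; apply: val_inj.
  by rewrite [LHS](@TtE _ g 0) ?Q0 ?linear0 ?addr0.
by rewrite [LHS](@TtE _ 0 f) ?linear0 ?add0r.
Qed.

(** Truncations converge weak-star to [f], and [Q'] is prescribed on them because
    they lie in L1. *)
Lemma weak_star_continuous_unique (Q' : Linfty mu -> Linfty mu) :
  continuous (Q' : weak_star mu -> weak_star mu) ->
  (forall f g, val f = val g -> val (Q' f) = val (S g)) -> Q' =1 Q.
Proof.
move=> cQ' Q'S f; apply: (Linfty_ext mu_sigma_finite) => g.
have [h gh] := preadjoint_exists mu_sigma_finite S_ds g.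
have [tr [tr_i tr_cvg _]] := truncations mu_sigma_finite S_ds.
have trf : (fun n => tr n f) @ \oo --> (f : weak_star mu).
  have FF : Filter ((fun n => tr n f) @ \oo) by exact: fmap_filter.
  apply/(cvg_weak_star _ FF) => g'.
  suff : (fun n => duality (tr n f) g') @ \oo --> duality f g' by [].
  apply: cvg_complex; rewrite dualityE; under eq_fun do rewrite dualityE /=.
    exact: tr_cvg.
  by have := tr_cvg f ((- 'i%C) *: g'); rewrite linearZ.
have Q'trf := cvg_comp _ _ trf (cQ' f).
have FF : Filter ((fun n => Q' (tr n f)) @ \oo) by exact: fmap_filter.
have := (cvg_weak_star (Q' f) FF).1 Q'trf g.
move=> /(cvg_Re (F := (fun n => Q' (tr n f)) @ \oo)).
under eq_fun do rewrite dualityE; rewrite dualityE /= => cvg1.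
rewrite (QE _ gh); apply: (cvg_unique _ cvg1).
  exact: (@norm_hausdorff R R^o).
suff : (fun n => pair (val (Q' (tr n f))) (val g)) @ \oo --> pair (val f) (val h) by [].
apply: cvg_trans (tr_cvg f h); apply: near_eq_cvg; apply: nearW => n /=.
have /mem_cL1P trS := tr_i n f.
rewrite (Q'S (tr n f) (CLp trS) erefl) -opE.
by rewrite (gh _ _ (ess_bounded_Linfty (tr n f)).2 (tr_i n f)).
Qed.

End extension_properties.

End extension_theorem.

Theorem theorem3p2 (d : measure_display) (Omega : measurableType d)
    (R : realType) (mu : {measure set Omega -> \bar R})
    (mu_sigma_finite : sigma_finite [set: Omega] mu)
    (T : {linear L1 mu -> L1 mu}) (T_ds : dunford_schwartz T) :
  exists! Tt : {linear L1Linfty mu -> L1Linfty mu},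
    [/\ forall f : L1 mu, Tt (L1_incl f) = L1_incl (T f),
        forall f : Linfty mu, (cLnorm +oo (Tt (Linfty_incl f)) <= cLnorm +oo f)%E &
        Linfty_weak_star_continuous Tt].
Proof.
have [Q [Q_le QE]] := Linfty_extension mu_sigma_finite T_ds.
have [Tt [TtS TtQ]] := L1Linfty_map_exists mu_sigma_finite T_ds QE.
exists Tt; split; first split=> //.
- by move=> f; rewrite TtQ; exact: Q_le.
- exists Q; first exact: TtQ.
  exact: (extension_weak_star_continuous mu_sigma_finite T_ds QE).
move=> Tt' [Tt'S _ [Q' Q'E Q'_cont]]; apply: linear_fun_ext => k.
have Q'Q : Q' =1 Q.
  apply: (weak_star_continuous_unique mu_sigma_finite T_ds QE Q'_cont) => f g fg.
  have E : Linfty_incl f = L1_incl g by apply: val_inj; exact: fg.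
  by have := Q'E f; rewrite E Tt'S => /(congr1 val) /= <-.
have [[g f] kE] := L1Linfty_decomposition k.
have -> : k = L1_incl g + Linfty_incl f by apply: val_inj; exact: kE.
by rewrite !linearD TtS TtQ Tt'S Q'E Q'Q.
Qed.
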